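(* Let $\mathbf X(t)=\int_{-\infty}^{t}e^{\mathbf A(t-u)}\mathbf e\,dS(u)$ and $Y(t)=\mathbf b'\mathbf X(t)$, $t\in\mathbb R$, where $\mathbf A,\mathbf e,\mathbf b$ and the semi-Levy process $S$ of period $T$ are as described in the context. Then the covariance function of $\mathbf X$ is periodic with period $T$, that is, $$\operatorname{cov}\big(\mathbf X(t+T),\mathbf X(t+h+T)\big)=\operatorname{cov}\big(\mathbf X(t),\mathbf X(t+h)\big)\quad\text{for all } t\in\mathbb R,\ h>0,$$ and consequently the process $Y$ is weakly periodically stationary with period $T$.
   Context: Driving process: let $r\in\mathbb N$ and $0=s_0<s_1<s_2<\cdots$ be such that the intervals $B_i=(s_{i-1},s_i]$, $i\in\mathbb N$, partition $(0,\infty)$ and $|B_{i+kr}|=|B_i|$ for all $i,k\in\mathbb N$; let $\lambda_i>0$ with $\lambda_{i+kr}=\lambda_i$. Put $a_i=|B_i|$ and $T=\sum_{i=1}^r a_i$. Let $\ell:\mathbb R\to(0,\infty)$ be the $T$-periodic function equal to $\lambda_i/a_i$ on $B_i$. Let $M$ be a Poisson random measure on $\mathbb R$ with mean measure $\ell(u)\,du$, and let its atoms carry i.i.d. real marks (jumps) distributed as a random variable $J$ with $E[J^2]<\infty$, independent of $M$. Let $\gamma\in\mathbb R$. The process $S=\{S(t),t\in\mathbb R\}$ satisfies $S(0)=0$ and, for $s<t$, $S(t)-S(s)=\gamma(t-s)+{}$(the sum of the jumps attached to the atoms of $M$ in $(s,t]$). Thus for $t\ge0$, $S(t)=\gamma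 t+\sum_{k=1}^{N(t)}J_k$ with $N(t)=M(0,t]$ and $J_k$ i.i.d. copies of $J$; $S$ has independent increments which are periodically stationary with period $T$, i.e. $S(t+T)-S(s+T)$ and $S(t)-S(s)$ have the same distribution. $S$ is assumed to be a second-order subordinator (nondecreasing, with finite second moments). CARMA coefficients: $0\le q<p$ are integers; $a(z)=z^p+a_1z^{p-1}+\cdots+a_p$ and $b(z)=b_0+b_1z+\cdots+b_{p-1}z^{p-1}$ have real coefficients, $b_q=1$, $b_j=0$ for $q<j<p$, and $a(z)$, $b(z)$ have no common factors (the $a_1,\dots,a_p$ here are not the lengths $a_i=|B_i|$). $\mathbf A$ is the $p\times p$ companion matrix with ones on the superdiagonal, last row $(-a_p,-a_{p-1},\dots,-a_1)$ and zeros elsewhere; $\mathbf e=(0,\dots,0,1)'\in\mathbb R^p$; $\mathbf b=(b_0,\dots,b_{p-1})'$; $'$ denotes transpose. All eigenvalues of $\mathbf A$ have negative real parts, and $\mathbf X(t)$ is independent of $\{S(v)-S(t):v>t\}$ for all $t\in\mathbb R$. The integral over $(-\infty,t]$ is the $L^2$-limit as $s\to-\infty$ of the integrals over $(s,t]$, which are taken as $L^2$-limits of Riemann–Stieltjes sums (equivalently pathwise). Notation: for square-integrable random vectors, $\operatorname{cov}(\mathbf U,\mathbf V)=E[(\mathbf U-E\mathbf U)(\mathbf V-E\mathbf V)']$. A square-integrable real process $Y$ is weakly periodically stationary with period $T$ if $E[Y(t+T)]=E[Y(t)]$ and $\operatorname{cov}(Y(t+T),Y(v+T))=\operatorname{cov}(Y(t),Y(v))$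 for all $t,v$. *)

(* Defs.v *)
From HB Require Import structures.
From mathcomp Require Import all_boot all_order all_algebra.
From mathcomp Require Import complex.
From mathcomp Require Import all_classical all_reals all_analysis.
From mathcomp Require Import measurable_realfun.

Set Implicit Arguments.
Unset Strict Implicit.
Unset Printing Implicit Defensive.

Import Order.TTheory GRing.Theory Num.Theory.
Import numFieldNormedType.Exports.

Local Open Scope classical_set_scope.
Local Open Scope ring_scope.

Section independence.
Context d (Omega : measurableType d) (R : realType) (P : probability Omega R).

(* Mutual independence of the family (X i), i in D: product rule over every
   finite subfamily. *)
Definition mutually_independent (I : choiceType) d' (E : measurableType d')
    (D : set I) (X : I -> Omega -> E) : Prop :=
  forall (s : seq I) (B : I -> set E), uniq s -> [set` s] `<=` D ->
    (forall i, measurable (B i)) ->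
    P (\bigcap_(i in [set` s]) (X i @^-1` B i))
    = (\prod_(i <- s) P (X i @^-1` B i))%E.

Definition sigma_of (I : Type) d' (E : measurableType d')
    (D : set I) (X : I -> Omega -> E) : set_system Omega :=
  <<s \bigcup_(i in D) preimage_set_system setT (X i) measurable >>.

Definition independent_sigma (F G : set_system Omega) : Prop :=
  forall A B, F A -> G B -> P (A `&` B) = (P A * P B)%E.

End independence.

Section driving_process.
Context (R : realType).

(* B_i = (s_{i-1}, s_i] and a_i = |B_i|; meaningful for i >= 1 only. *)
Definition block (s : nat -> R) (i : nat) : set R := `]s i.-1, s i]%classic.
Definition block_length (s : nat -> R) (i : nat) : R := s i - s i.-1.

Definition period (r : nat) (s : nat -> R) : R :=
  \sum_(1 <= i < r.+1) block_length s i.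

Record periodic_blocks (r : nat) (s lambda : nat -> R) : Prop := {
  periodic_blocks_r_gt0 : (0 < r)%N ;
  periodic_blocks_s0 : s 0%N = 0 ;
  periodic_blocks_s_lt : forall i, s i < s i.+1 ;
  periodic_blocks_cover :
    \bigcup_(i in [set i | (0 < i)%N]) block s i = `]0, +oo[%classic ;
  periodic_blocks_length : forall i k, (0 < i)%N ->
    block_length s (i + k * r)%N = block_length s i ;
  periodic_blocks_lambda_gt0 : forall i, (0 < i)%N -> 0 < lambda i ;
  periodic_blocks_lambda : forall i k, (0 < i)%N ->
    lambda (i + k * r)%N = lambda i }.

Record periodic_intensity (r : nat) (s lambda : nat -> R) (ell : R -> R)
    : Prop := {
  periodic_intensity_gt0 : forall u, 0 < ell u ;
  periodic_intensity_periodic : forall u, ell (u + period r s) = ell u ;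
  periodic_intensity_block : forall i u, (0 < i)%N -> block s i u ->
    ell u = lambda i / block_length s i }.

Definition mean_measure (ell : R -> R) (A : set R) : \bar R :=
  (\int[@lebesgue_measure R]_(u in A) (ell u)%:E)%E.

Context d (Omega : measurableType d) (P : probability Omega R).

(* The random measure whose atoms, counted with multiplicity, are (tau k). *)
Definition point_measure (tau : int -> Omega -> R) (A : set R) (w : Omega)
    : \bar R :=
  counting [set k | A (tau k w)].

(* The library's [poisson_pmf] agrees with this for m > 0, but [poisson_pmf 0 n]
   is 1 for every n, which is not the degenerate law at 0 needed for null
   sets. *)
Definition poisson_mass (m : R) (n : nat) : R :=
  expR (- m) * m ^+ n / n`!%:R.

Record poisson_random_measure (mu : set R -> \bar R)
    (M : set R -> Omega -> \bar R) : Prop := {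
  prm_measurable : forall A, measurable A -> measurable_fun setT (M A) ;
  prm_poisson : forall A (n : nat), measurable A -> (mu A < +oo)%E ->
    P [set w | M A w = n%:R%:E] = (poisson_mass (fine (mu A)) n)%:E ;
  prm_independent : forall n (A : 'I_n -> set R),
    (forall i, measurable (A i)) -> trivIset setT A ->
    mutually_independent P setT (fun i => M (A i)) }.

(* The intensity is locally integrable and bounded away from 0, so almost
   surely the atoms form a strictly increasing two-sided sequence; they are
   numbered so that tau_0 <= 0 < tau_1, whence
   (sum of the jumps in (0, t]) = J_1 + ... + J_{N(t)} with N(t) = M(0, t]. *)
Record poisson_atoms (ell : R -> R) (tau : int -> {RV P >-> R}) : Prop := {
  poisson_atoms_prm :
    poisson_random_measure (mean_measure ell) (point_measure tau) ;
  poisson_atoms_ordered : {ae P, forall w,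
    (forall k : int, tau k w < tau (k + 1) w) /\ tau 0 w <= 0 < tau 1 w} }.

Record iid_marks (tau J : int -> {RV P >-> R}) (J0 : {RV P >-> R})
    : Prop := {
  iid_marks_square_integrable : (J0 : Omega -> R) \in Lfun P 2%:E ;
  iid_marks_law : forall k (B : set R), measurable B ->
    distribution P (J k) B = distribution P J0 B ;
  iid_marks_independent : mutually_independent P setT J ;
  iid_marks_independent_atoms : independent_sigma P
    (sigma_of setT J)
    (sigma_of [set A : set R | measurable A] (point_measure tau)) }.

(* The set of atoms in (s, t] is almost surely finite; on the exceptional null
   set the finitely supported sum below may take its default value 0. *)
Definition jump_sum (tau J : int -> Omega -> R) (s t : R) (w : Omega) : R :=
  \sum_(k \in [set k : int | s < tau k w <= t]) J k w.

Record second_order_subordinator (gamma : R) (tau J : int -> Omega -> R)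
    (S : R -> {RV P >-> R}) : Prop := {
  sos_path : {ae P, forall w, S 0 w = 0 /\
    forall s t, s < t -> S t w - S s w = gamma * (t - s) + jump_sum tau J s t w} ;
  sos_nondecreasing : {ae P, forall w, forall s t, s <= t -> S s w <= S t w} ;
  sos_square_integrable : forall t, (S t : Omega -> R) \in Lfun P 2%:E }.

End driving_process.

Section carma_coefficients.
Context (R : realType).

(* a(z) = z^p + a_1 z^{p-1} + ... + a_p; only a_1, ..., a_p are used. *)
Definition ar_poly (p : nat) (a : nat -> R) : {poly R} :=
  'X^p + \sum_(1 <= i < p.+1) a i *: 'X^(p - i).

Definition ma_poly (p : nat) (b : nat -> R) : {poly R} :=
  \sum_(0 <= i < p) b i *: 'X^i.

(* Indices start at 0: the last row is (- a_p, - a_{p-1}, ..., - a_1). *)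
Definition carma_A (p : nat) (a : nat -> R) : 'M[R]_p :=
  \matrix_(i, j) (if i.+1 == p then - a (p - j)%N
                  else (j == i.+1 :> nat)%:R).

Definition carma_e (p : nat) : 'cV[R]_p := \col_i (i.+1 == p)%:R.

Definition carma_b (p : nat) (b : nat -> R) : 'cV[R]_p := \col_i b i.

Record carma_coefficients (p q : nat) (a b : nat -> R) : Prop := {
  carma_q_lt_p : (q < p)%N ;
  carma_b_q : b q = 1 ;
  carma_b_high : forall j, (q < j < p)%N -> b j = 0 ;
  carma_coprime : coprimep (ar_poly p a) (ma_poly p b) }.

Definition eigenvalues_negative_real_part (p : nat) (A : 'M[R]_p) : Prop :=
  forall z : complex R,
    eigenvalue (map_mx (real_complex R) A) z ->
    complex.Re z < 0.

Definition expm (p : nat) (A : 'M[R]_p) : 'M[R]_p :=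
  limn (series (fun k => (k`!%:R)^-1 *: (A ^+ k))).

End carma_coefficients.

Section L2_integrals.
Context (R : realType) d (Omega : measurableType d) (P : probability Omega R).
Variable p : nat.

Definition square_integrable_vec (U : Omega -> 'cV[R]_p) : Prop :=
  forall i, (fun w => U w i 0) \in Lfun P 2%:E.

Definition mean_square_dist (U V : Omega -> 'cV[R]_p) : \bar R :=
  (\sum_i 'E_P[fun w => ((U w i 0 - V w i 0) ^+ 2)%R])%E.

(* The division points are a :: u and the i-th tag is xi i. *)
Definition tagged_partition (a b delta : R) (u : seq R) (xi : nat -> R)
    : Prop :=
  itv_partition a b u /\
  forall i, (i < size u)%N ->
    nth a (a :: u) i <= xi i <= nth a (a :: u) i.+1 /\
    nth a (a :: u) i.+1 - nth a (a :: u) i < delta.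

Definition rs_sum (F : R -> 'cV[R]_p) (S : R -> Omega -> R)
    (a : R) (u : seq R) (xi : nat -> R) (w : Omega) : 'cV[R]_p :=
  \sum_(0 <= i < size u)
    (S (nth a (a :: u) i.+1) w - S (nth a (a :: u) i) w) *: F (xi i).

(* U is the integral of F dS over (a, b]: the L^2-limit of the
   Riemann-Stieltjes sums as the mesh tends to 0. *)
Definition is_rs_integral (F : R -> 'cV[R]_p) (S : R -> Omega -> R) (a b : R)
    (U : Omega -> 'cV[R]_p) : Prop :=
  square_integrable_vec U /\
  forall eps : R, 0 < eps -> exists2 delta : R, 0 < delta &
    forall u xi, tagged_partition a b delta u xi ->
      (mean_square_dist (rs_sum F S a u xi) U < eps%:E)%E.

(* U is the integral of F dS over (-oo, b]. *)
Definition is_improper_rs_integral (F : R -> 'cV[R]_p) (S : R -> Omega -> R)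
    (b : R) (U : Omega -> 'cV[R]_p) : Prop :=
  square_integrable_vec U /\
  exists V : R -> Omega -> 'cV[R]_p,
    (forall a, a < b -> is_rs_integral F S a b (V a)) /\
    mean_square_dist (V a) U @[a --> -oo%R] --> 0%E.

End L2_integrals.

Section second_order.
Context (R : realType) d (Omega : measurableType d) (P : probability Omega R).

Definition covariance_mx (m n : nat) (U : Omega -> 'cV[R]_m)
    (V : Omega -> 'cV[R]_n) : 'M[\bar R]_(m, n) :=
  \matrix_(i, j) covariance P (fun w => U w i 0) (fun w => V w j 0).

Record weakly_periodically_stationary (T : R) (Y : R -> Omega -> R)
    : Prop := {
  wps_square_integrable : forall t, Y t \in Lfun P 2%:E ;
  wps_mean : forall t, ('E_P[Y (t + T)%R] = 'E_P[Y t])%E ;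
  wps_covariance : forall t v,
    covariance P (Y (t + T)) (Y (v + T)) = covariance P (Y t) (Y v) }.

End second_order.

(* Main.v *)
Require Import Defs.
From HB Require Import structures.
From mathcomp Require Import all_boot all_order all_algebra.
From mathcomp Require Import finmap zify ring lra.
From mathcomp Require Import all_classical all_reals all_analysis.
From mathcomp Require Import measurable_realfun.

(** The covariances of [X], and hence of [Y], are limits of bilinear expressions
    in the increments of [S], weighted by a kernel that depends on [t - u] only.
    They are periodic because translating time by the period [T] preserves the
    means and the mutual inner products of the increments.

    Increments.  Write [I] for the random set of the labels [k] with
    [a < tau k <= b].  The events [I = F], with [F] a finite set of labels, are
    almost surely determined by the counts of atoms in intervals
    ([ordered_label_count], [atoms_event_count]), hence independent of the marks.
    On such an event [S b - S a] is a constant plus the sum of [J k] over [F],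
    and the second moment of that sum depends only on the cardinal of [F]
    ([mark_sum_sqr]).  Summing over [F] expresses [E (S b - S a + c)^2] through
    [b - a], [c] and the law of the number of atoms in [(a, b]]
    ([integral_increment_sqr]).  That number is Poisson, and its mean is the
    integral of a [T]-periodic function, so it keeps its law when [a] and [b] are
    both translated by [T].  The choices [c = 0] and [c = 1] give the invariance
    of the second moments and of the means of the increments.

    Polarization.  The inner product of two increments is a combination of the
    second moments of four others ([dot_increments]), whence inner products of
    linear combinations of increments are invariant too ([dot_comb_shift]).

    Integrals.  A Riemann-Stieltjes sum for [X t] becomes one for [X (t + T)]
    when its division points and tags are translated by [T].  With a fine enough
    partition of a long enough interval, one combination of increments and its
    translate therefore approximate [X t] and [X (t + T)] simultaneously
    ([improper_rs_integral_comb_limits]), and the invariance passes to the limit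
    by continuity of the inner product ([cvg_dot]). *)

Set Implicit Arguments.
Unset Strict Implicit.
Unset Printing Implicit Defensive.

Import Order.TTheory GRing.Theory Num.Theory.
Import numFieldNormedType.Exports.

Local Open Scope classical_set_scope.
Local Open Scope ring_scope.

(** * The inner product of square-integrable random variables *)

Section square_integrable.
Context d (Omega : measurableType d) (R : realType) (P : probability Omega R).
Implicit Types X Y Z : Omega -> R.

Let two_ge1E : (1 <= 2%:E :> \bar R)%E.
Proof. by rewrite lee_fin ler1n. Qed.

Lemma Lfun2P X : measurable_fun setT X ->
  X \in Lfun P 2%:E <-> (\int[P]_w (X w ^+ 2)%:E < +oo)%E.
Proof.
move=> mX; split.
  move=> /Lfun2_integrable_sqr/integrableP[_]; apply: le_lt_trans.
  rewrite le_eqVlt; apply/orP; left; apply/eqP/eq_integral => w _ /=.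
  by rewrite ger0_norm// sqr_ge0.
move=> XX; apply/andP; split; rewrite inE//=.
rewrite /finite_norm unlock /Lnorm/= poweR_lty//.
apply: le_lt_trans XX; rewrite le_eqVlt; apply/orP; left; apply/eqP.
by apply: eq_integral => w _ /=; rewrite powR_mulrn// real_normK// num_real.
Qed.

Lemma Lfun2D X Y : X \in Lfun P 2%:E -> Y \in Lfun P 2%:E ->
  (fun w => X w + Y w) \in Lfun P 2%:E.
Proof.
by have [_ D] := Lfun_addr_closed P two_ge1E; exact: D.
Qed.

Lemma Lfun2Z c X : X \in Lfun P 2%:E -> (fun w => c * X w) \in Lfun P 2%:E.
Proof.
move=> X2; rewrite (_ : (fun w => c * X w) = c \o* X).
  by apply: Lfun_scale; rewrite ?ler1n.
by apply/funext => w /=; rewrite mulrC.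
Qed.

Lemma Lfun2N X : X \in Lfun P 2%:E -> (fun w => - X w) \in Lfun P 2%:E.
Proof.
move=> X2; rewrite (_ : (fun w => - X w) = (fun w => (-1) * X w)).
  exact: Lfun2Z.
by apply/funext => w; rewrite mulN1r.
Qed.

Lemma Lfun2B X Y : X \in Lfun P 2%:E -> Y \in Lfun P 2%:E ->
  (fun w => X w - Y w) \in Lfun P 2%:E.
Proof. by move=> X2 Y2; apply: Lfun2D => //; exact: Lfun2N. Qed.

Lemma Lfun2_cst c : (fun=> c) \in Lfun P 2%:E.
Proof. exact: Lfun_cst. Qed.

Lemma Lfun2_sum I (s : seq I) (X : I -> Omega -> R) :
  (forall i, X i \in Lfun P 2%:E) ->
  (fun w => \sum_(i <- s) X i w) \in Lfun P 2%:E.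
Proof.
move=> X2; elim: s => [|i s IH].
  by under eq_fun do rewrite big_nil; exact: Lfun2_cst.
by under eq_fun do rewrite big_cons; exact: Lfun2D.
Qed.

(** Taken in [R] rather than in [\bar R], so that moments can be computed with in
    a field; it has this meaning for square-integrable arguments only. *)
Definition dot X Y : R := fine ('E_P[fun w => (X w * Y w)%R])%E.

Lemma dotC X Y : dot X Y = dot Y X.
Proof. by rewrite /dot; under eq_fun do rewrite mulrC. Qed.

Lemma dot_ge0 X : 0 <= dot X X.
Proof. by apply: fine_ge0; apply: expectation_ge0 => w; rewrite -expr2 sqr_ge0. Qed.

Lemma dotE X Y : X \in Lfun P 2%:E -> Y \in Lfun P 2%:E ->
  ('E_P[fun w => (X w * Y w)%R] = (dot X Y)%:E)%E.
Proof.
move=> X2 Y2; rewrite /dot fineK// expectation_fin_num//.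
exact: Lfun2_mul_Lfun1.
Qed.

Lemma dotDl X Y Z : X \in Lfun P 2%:E -> Y \in Lfun P 2%:E ->
  Z \in Lfun P 2%:E -> dot (fun w => X w + Y w) Z = dot X Z + dot Y Z.
Proof.
move=> X2 Y2 Z2; apply: EFin_inj.
rewrite EFinD -!dotE//; last exact: Lfun2D.
rewrite -expectationD; try exact: Lfun2_mul_Lfun1.
by congr expectation; apply/funext => w /=; rewrite mulrDl.
Qed.

Lemma dotZl c X Z : X \in Lfun P 2%:E -> Z \in Lfun P 2%:E ->
  dot (fun w => c * X w) Z = c * dot X Z.
Proof.
move=> X2 Z2; apply: EFin_inj.
rewrite EFinM -!dotE//; last exact: Lfun2Z.
rewrite -expectationZl; last exact: Lfun2_mul_Lfun1.
by congr expectation; apply/funext => w /=; ring.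
Qed.

Lemma dotDr X Y Z : X \in Lfun P 2%:E -> Y \in Lfun P 2%:E ->
  Z \in Lfun P 2%:E -> dot Z (fun w => X w + Y w) = dot Z X + dot Z Y.
Proof. by move=> X2 Y2 Z2; rewrite dotC dotDl// !(dotC _ Z). Qed.

Lemma dotZr c X Z : X \in Lfun P 2%:E -> Z \in Lfun P 2%:E ->
  dot Z (fun w => c * X w) = c * dot Z X.
Proof. by move=> X2 Z2; rewrite dotC dotZl// dotC. Qed.

Lemma dotBl X Y Z : X \in Lfun P 2%:E -> Y \in Lfun P 2%:E ->
  Z \in Lfun P 2%:E -> dot (fun w => X w - Y w) Z = dot X Z - dot Y Z.
Proof.
move=> X2 Y2 Z2; rewrite dotDl//; last exact: Lfun2N.
congr (_ + _); rewrite -mulN1r -dotZl//; congr dot.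
by apply/funext => w; rewrite mulN1r.
Qed.

Lemma dotBr X Y Z : X \in Lfun P 2%:E -> Y \in Lfun P 2%:E ->
  Z \in Lfun P 2%:E -> dot Z (fun w => X w - Y w) = dot Z X - dot Z Y.
Proof. by move=> X2 Y2 Z2; rewrite dotC dotBl// !(dotC _ Z). Qed.

Lemma dot_suml I (s : seq I) (X : I -> Omega -> R) Z :
  (forall i, X i \in Lfun P 2%:E) -> Z \in Lfun P 2%:E ->
  dot (fun w => \sum_(i <- s) X i w) Z = \sum_(i <- s) dot (X i) Z.
Proof.
move=> X2 Z2; elim: s => [|i s IH].
  rewrite big_nil; under eq_fun do rewrite big_nil.
  rewrite /dot; under eq_fun do rewrite mul0r.
  by rewrite expectation_cst.
rewrite big_cons -IH -dotDl//; last exact: Lfun2_sum.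
by congr dot; apply/funext => w; rewrite big_cons.
Qed.

Lemma dot_sumr I (s : seq I) (X : I -> Omega -> R) Z :
  (forall i, X i \in Lfun P 2%:E) -> Z \in Lfun P 2%:E ->
  dot Z (fun w => \sum_(i <- s) X i w) = \sum_(i <- s) dot Z (X i).
Proof.
by move=> X2 Z2; rewrite dotC dot_suml//; apply: eq_bigr => i _; rewrite dotC.
Qed.

Lemma expectation_dot X : X \in Lfun P 2%:E ->
  ('E_P[X] = (dot X (fun=> 1%R))%:E)%E.
Proof.
move=> X2; rewrite -dotE//; last exact: Lfun2_cst.
by congr expectation; apply/funext => w; rewrite mulr1.
Qed.

Lemma covariance_dot X Y : X \in Lfun P 2%:E -> Y \in Lfun P 2%:E ->
  covariance P X Y
  = (dot X Y - dot X (fun=> 1) * dot Y (fun=> 1))%:E.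
Proof.
move=> X2 Y2; have P1 : P setT \is a fin_num by exact: fin_num_measure.
have sub := Lfun_subset12 P1; rewrite (covarianceE (sub _ X2) (sub _ Y2)).
  by rewrite EFinB EFinM -dotE// -!expectation_dot.
exact: Lfun2_mul_Lfun1.
Qed.

(** The square norm of [X - t Y] is nonnegative for the minimizing [t]; when
    [dot Y Y = 0] it is affine in [t] and takes the value [-1] unless
    [dot X Y = 0]. *)
Lemma dot_CauchySchwarz X Y : X \in Lfun P 2%:E -> Y \in Lfun P 2%:E ->
  dot X Y ^+ 2 <= dot X X * dot Y Y.
Proof.
move=> X2 Y2.
have Q t : 0 <= dot X X - 2 * t * dot X Y + t ^+ 2 * dot Y Y.
  have := dot_ge0 (fun w => X w - t * Y w).
  have tY2 := Lfun2Z t Y2; have XtY2 := Lfun2B X2 tY2.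
  rewrite dotBl// !dotBr// !dotZl// !dotZr// (dotC Y X) => H.
  by apply: le_trans H _; rewrite le_eqVlt; apply/orP; left; apply/eqP; ring.
have [Y0|Y0] := eqVneq (dot Y Y) 0; last first.
  have Ygt0 : 0 < dot Y Y by rewrite lt_def Y0 dot_ge0.
  have := Q (dot X Y / dot Y Y).
  have -> : dot X X - 2 * (dot X Y / dot Y Y) * dot X Y
      + (dot X Y / dot Y Y) ^+ 2 * dot Y Y
    = (dot X X * dot Y Y - dot X Y ^+ 2) / dot Y Y by field.
  by rewrite pmulr_lge0 ?invr_gt0// subr_ge0.
rewrite Y0 mulr0; have [->|XY0] := eqVneq (dot X Y) 0; first by rewrite expr0n.
have := Q ((dot X X + 1) / (2 * dot X Y)); rewrite Y0.
have -> : dot X X - 2 * ((dot X X + 1) / (2 * dot X Y)) * dot X Y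
    + ((dot X X + 1) / (2 * dot X Y)) ^+ 2 * 0 = - 1 by field.
by rewrite oppr_ge0 ler10.
Qed.

Lemma dot_le_sqrt X Y : X \in Lfun P 2%:E -> Y \in Lfun P 2%:E ->
  `|dot X Y| <= Num.sqrt (dot X X) * Num.sqrt (dot Y Y).
Proof.
move=> X2 Y2; rewrite -sqrtrM ?dot_ge0// -sqrtr_sqr ler_wsqrtr//.
exact: dot_CauchySchwarz.
Qed.

(** The inner product is continuous for mean-square convergence in both
    arguments. *)
Lemma cvg_dot (U V : nat -> Omega -> R) X Y :
  (forall n, U n \in Lfun P 2%:E) -> (forall n, V n \in Lfun P 2%:E) ->
  X \in Lfun P 2%:E -> Y \in Lfun P 2%:E ->
  dot (fun w => U n w - X w) (fun w => U n w - X w) @[n --> \oo] --> 0 ->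
  dot (fun w => V n w - Y w) (fun w => V n w - Y w) @[n --> \oo] --> 0 ->
  dot (U n) (V n) @[n --> \oo] --> dot X Y.
Proof.
move=> U2 V2 X2 Y2 UX VY.
have UX2 n := Lfun2B (U2 n) X2; have VY2 n := Lfun2B (V2 n) Y2.
have sq (W : nat -> R) l : W n @[n --> \oo] --> l ->
    Num.sqrt (W n) @[n --> \oo] --> Num.sqrt l.
  by move=> Wl; exact: (cvg_comp _ _ Wl (@sqrt_continuous R l)).
have small (A B : nat -> Omega -> R) (l : R) :
    (forall n, A n \in Lfun P 2%:E) -> (forall n, B n \in Lfun P 2%:E) ->
    dot (A n) (A n) @[n --> \oo] --> 0 -> dot (B n) (B n) @[n --> \oo] --> l ->
    dot (A n) (B n) @[n --> \oo] --> 0.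
  move=> A2 B2 A0 Bl; apply: norm_cvg0.
  apply: (@squeeze_cvgr _ _ _ _ (fun=> 0)
    (fun n => Num.sqrt (dot (A n) (A n)) * Num.sqrt (dot (B n) (B n)))).
  - by near=> n; rewrite normr_ge0 dot_le_sqrt.
  - exact: cvg_cst.
  - have := cvgM (sq _ _ A0) (sq _ _ Bl).
    rewrite sqrtr0 mul0r => H. exact: H.
(* bilinear expansion around (X, Y) *)
have E n : dot (U n) (V n) = dot X Y + dot (fun w => U n w - X w) Y
    + dot (fun w => V n w - Y w) X
    + dot (fun w => U n w - X w) (fun w => V n w - Y w).
  by rewrite !dotBl// !dotBr// (dotC Y X) (dotC (V n) X); ring.
have t1 := small _ _ _ UX2 (fun=> Y2) UX (cvg_cst _).
have t2 := small _ _ _ VY2 (fun=> X2) VY (cvg_cst _).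
have t3 := small _ _ _ UX2 VY2 UX VY.
rewrite (_ : (fun n => _) = fun n => dot X Y + dot (fun w => U n w - X w) Y
  + dot (fun w => V n w - Y w) X
  + dot (fun w => U n w - X w) (fun w => V n w - Y w)); last exact/funext.
rewrite -[X in _ --> X]addr0 -[X in _ --> X + _]addr0 -[X in _ --> X + _ + _]addr0.
exact: (cvgD (cvgD (cvgD (cvg_cst _) (t1 _)) (t2 _)) t3).
Unshelve. all: by end_near. Qed.

End square_integrable.

(** * Linear combinations of increments and their mean-square limits *)

Section shift_invariance.
Context d (Omega : measurableType d) (R : realType) (P : probability Omega R).
Local Notation dot := (dot P).

Definition increment_comb (S : R -> Omega -> R) (L : seq (R * R * R)) (w : Omega)
    : R :=
  \sum_(x <- L) x.2 * (S x.1.2 w - S x.1.1 w).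

Definition shift_comb (T : R) (L : seq (R * R * R)) : seq (R * R * R) :=
  [seq (x.1.1 + T, x.1.2 + T, x.2) | x <- L].

(** The same combination has to serve both limits: this is what transports
    the invariance of the combinations to the pair of limits. *)
Definition comb_limits (S : R -> Omega -> R) (T : R) (X X' : Omega -> R) : Prop :=
  forall eps : R, 0 < eps -> exists L,
    dot (fun w => increment_comb S L w - X w)
        (fun w => increment_comb S L w - X w) < eps /\
    dot (fun w => increment_comb S (shift_comb T L) w - X' w)
        (fun w => increment_comb S (shift_comb T L) w - X' w) < eps.

Section invariant.
Variables (S : R -> Omega -> R) (T : R).
Hypothesis S2 : forall t, S t \in Lfun P 2%:E.
Hypothesis S_mean : forall a b,
  dot (fun w => S (b + T) w - S (a + T) w) (fun=> 1)
  = dot (fun w => S b w - S a w) (fun=> 1).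
Hypothesis S_var : forall a b,
  dot (fun w => S (b + T) w - S (a + T) w) (fun w => S (b + T) w - S (a + T) w)
  = dot (fun w => S b w - S a w) (fun w => S b w - S a w).

Lemma increment_comb_Lfun2 L : increment_comb S L \in Lfun P 2%:E.
Proof. by apply: Lfun2_sum => x; apply: Lfun2Z; exact: Lfun2B. Qed.

(** Polarization: the terms [dot (S t) (S t)] cancel out. *)
Lemma dot_increments a b c e :
  dot (fun w => S b w - S a w) (fun w => S e w - S c w) =
  2^-1 * (dot (fun w => S b w - S c w) (fun w => S b w - S c w)
        + dot (fun w => S e w - S a w) (fun w => S e w - S a w)
        - dot (fun w => S b w - S e w) (fun w => S b w - S e w)
        - dot (fun w => S c w - S a w) (fun w => S c w - S a w)).
Proof.
have B t u := Lfun2B (S2 t) (S2 u).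
rewrite !dotBl// !dotBr//.
rewrite (dotC _ (S c) (S b)) (dotC _ (S a) (S e)) (dotC _ (S e) (S b)).
by rewrite (dotC _ (S a) (S c)); field.
Qed.

Lemma dot_increments_shift a b c e :
  dot (fun w => S (b + T) w - S (a + T) w) (fun w => S (e + T) w - S (c + T) w)
  = dot (fun w => S b w - S a w) (fun w => S e w - S c w).
Proof. by rewrite dot_increments !S_var -dot_increments. Qed.

Lemma dot_comb_shift L L' :
  dot (increment_comb S (shift_comb T L)) (increment_comb S (shift_comb T L'))
  = dot (increment_comb S L) (increment_comb S L').
Proof.
have B t u := Lfun2B (S2 t) (S2 u).
have Z t u c := Lfun2Z c (B t u).
rewrite dot_suml; [|by move=> x; exact: Z|exact: increment_comb_Lfun2].
rewrite dot_suml; [|by move=> x; exact: Z|exact: increment_comb_Lfun2].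
rewrite big_map; apply: eq_bigr => x _ /=.
rewrite dot_sumr; [|by move=> y; exact: Z|exact: Z].
rewrite dot_sumr; [|by move=> y; exact: Z|exact: Z].
rewrite big_map; apply: eq_bigr => y _ /=.
by rewrite !dotZl// !dotZr// dot_increments_shift.
Qed.

Lemma dot_comb_shift1 L :
  dot (increment_comb S (shift_comb T L)) (fun=> 1)
  = dot (increment_comb S L) (fun=> 1).
Proof.
have B t u := Lfun2B (S2 t) (S2 u).
have Z t u c := Lfun2Z c (B t u).
have L1 := Lfun2_cst P 1.
rewrite !dot_suml//; try by move=> x; exact: Z.
rewrite big_map; apply: eq_bigr => x _ /=.
by rewrite !dotZl// S_mean.
Qed.

Lemma comb_limits_seq X X' : comb_limits S T X X' ->
  exists L : nat -> seq (R * R * R),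
    dot (fun w => increment_comb S (L n) w - X w)
        (fun w => increment_comb S (L n) w - X w) @[n --> \oo] --> 0 /\
    dot (fun w => increment_comb S (shift_comb T (L n)) w - X' w)
        (fun w => increment_comb S (shift_comb T (L n)) w - X' w)
      @[n --> \oo] --> 0.
Proof.
move=> XX'; have pos n : 0 < (n.+1%:R : R)^-1 by rewrite invr_gt0.
have [L HL] := choice (fun n => XX' _ (pos n)).
exists L; split; apply: (@squeeze_cvgr _ _ _ _ (fun=> 0) (@harmonic R)).
- by near=> n; rewrite dot_ge0/= ltW// (HL n).1.
- exact: cvg_cst.
- exact: cvg_harmonic.
- by near=> n; rewrite dot_ge0/= ltW// (HL n).2.
- exact: cvg_cst.
- exact: cvg_harmonic.
Unshelve. all: by end_near. Qed.

Lemma comb_limits_dot X X' Y Y' :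
  X \in Lfun P 2%:E -> X' \in Lfun P 2%:E ->
  Y \in Lfun P 2%:E -> Y' \in Lfun P 2%:E ->
  comb_limits S T X X' -> comb_limits S T Y Y' -> dot X' Y' = dot X Y.
Proof.
move=> X2 X'2 Y2 Y'2 /comb_limits_seq[L [LX LX']] /comb_limits_seq[K [KY KY']].
have c2 := increment_comb_Lfun2.
apply: (@cvg_unique R^o _ (dot (increment_comb S (L n)) (increment_comb S (K n))
  @[n --> \oo])) => //.
- have -> : (fun n => dot (increment_comb S (L n)) (increment_comb S (K n))) =
    (fun n => dot (increment_comb S (shift_comb T (L n)))
                  (increment_comb S (shift_comb T (K n)))).
    by apply/funext => n; rewrite dot_comb_shift.
  exact: cvg_dot.
- exact: cvg_dot.
Qed.

Lemma comb_limits_mean X X' :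
  X \in Lfun P 2%:E -> X' \in Lfun P 2%:E ->
  comb_limits S T X X' -> dot X' (fun=> 1) = dot X (fun=> 1).
Proof.
move=> X2 X'2 /comb_limits_seq[L [LX LX']].
have c2 := increment_comb_Lfun2; have one2 := Lfun2_cst P 1.
have one0 : dot (fun w : Omega => 1 - 1) (fun w => 1 - 1) @[n --> \oo] --> 0.
  rewrite (_ : dot _ _ = 0); first exact: cvg_cst.
  by rewrite dotBl ?Lfun2B// subrr.
apply: (@cvg_unique R^o _ (dot (increment_comb S (L n)) (fun=> 1)
  @[n --> \oo])) => //.
- have -> : (fun n => dot (increment_comb S (L n)) (fun=> 1)) =
    (fun n => dot (increment_comb S (shift_comb T (L n))) (fun=> 1)).
    by apply/funext => n; rewrite dot_comb_shift1.
  exact: (cvg_dot (V := fun=> fun=> 1)).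
- exact: (cvg_dot (V := fun=> fun=> 1)).
Qed.

End invariant.

Lemma uniform_partition (a b delta : R) : a < b -> 0 < delta ->
  exists u xi, tagged_partition a b delta u xi.
Proof.
move=> ab d0.
pose n := (Num.truncn ((b - a) / delta)).+1; pose h := (b - a) / n%:R.
have ba : 0 < b - a by rewrite subr_gt0.
have n0 : 0 < n%:R :> R by rewrite ltr0n.
have h0 : 0 < h by rewrite divr_gt0.
have hd : h < delta.
  rewrite /h ltr_pdivrMr// mulrC -ltr_pdivrMr//.
  exact: truncnS_gt.
pose u := mkseq (fun i => a + i.+1%:R * h) n.
have nthu i : (i <= n)%N -> nth a (a :: u) i = a + i%:R * h.
  by case: i => [|i] ni /=; [rewrite mul0r addr0|rewrite nth_mkseq].
exists u, (fun i => nth a (a :: u) i); split.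
  split; last first.
    rewrite (last_nth a) size_mkseq nthu// /h.
    by apply/eqP; field; rewrite gt_eqF.
  apply/(pathP a) => i; rewrite size_mkseq => ni.
  rewrite nthu ?(ltnW ni)// nth_mkseq//= ltrD2l ltr_pM2r// ltr_nat ltnSn.
  by [].
move=> i; rewrite size_mkseq => ni; rewrite !nthu// ?(ltnW ni)//.
have E : a + i.+1%:R * h - (a + i%:R * h) = h by rewrite -natr1; ring.
by rewrite lexx E hd -subr_ge0 E ltW.
Qed.

Lemma nth_shift (T a : R) u i : (i <= size u)%N ->
  nth (a + T) (a + T :: [seq x + T | x <- u]) i = nth a (a :: u) i + T.
Proof. by move=> iu; rewrite -(nth_map a (a + T) (+%R^~ T)). Qed.

Lemma tagged_partition_shift (T a b delta : R) u xi :
  tagged_partition a b delta u xi ->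
  tagged_partition (a + T) (b + T) delta [seq x + T | x <- u]
    (fun i => xi i + T).
Proof.
move=> [[pu /eqP lu] H]; split.
  split; last by rewrite (last_map (+%R^~ T)) lu.
  by apply: (homo_path _ pu) => x y; rewrite ltrD2r.
move=> i; rewrite size_map => iu; rewrite !nth_shift// ?(ltnW iu)//.
have [/andP[xi1 xi2] mesh] := H _ iu.
by rewrite !lerD2r xi1 xi2; split=> //; rewrite opprD addrACA subrr addr0.
Qed.

Section integrals.
Variable p : nat.
Implicit Types (F : R -> 'cV[R]_p) (S : R -> Omega -> R).

Definition rs_comb F (i : 'I_p) (a : R) (u : seq R) (xi : nat -> R)
    : seq (R * R * R) :=
  [seq (nth a (a :: u) k, nth a (a :: u) k.+1, F (xi k) i 0)
  | k <- index_iota 0 (size u)].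

Lemma rs_sum_comb F S i a u xi w :
  rs_sum F S a u xi w i 0 = increment_comb S (rs_comb F i a u xi) w.
Proof.
rewrite /rs_sum summxE /increment_comb big_map; apply: eq_bigr => k _ /=.
by rewrite mxE mulrC.
Qed.

Lemma shift_rs_comb F F' T i a u xi : (forall v, F' (v + T) = F v) ->
  rs_comb F' i (a + T) [seq x + T | x <- u] (fun k => xi k + T)
  = shift_comb T (rs_comb F i a u xi).
Proof.
move=> FF'; rewrite /shift_comb /rs_comb size_map -map_comp.
apply/eq_in_map => k; rewrite mem_index_iota /= => ku.
by rewrite FF' nth_shift ?(ltnW ku)// (nth_map a).
Qed.

Lemma mean_square_dist_dot (U V : Omega -> 'cV[R]_p) (eps : R) i :
  square_integrable_vec P U -> square_integrable_vec P V ->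
  (mean_square_dist P U V < eps%:E)%E ->
  dot (fun w => U w i 0 - V w i 0) (fun w => U w i 0 - V w i 0) < eps.
Proof.
move=> U2 V2; rewrite -lte_fin; apply: le_lt_trans.
rewrite -dotE; try exact: Lfun2B.
rewrite /mean_square_dist (bigD1 i)//= -[leLHS]adde0; apply: leeD.
  by under [in leRHS]eq_fun do rewrite expr2.
by apply: sume_ge0 => j _; apply: expectation_ge0 => w; rewrite sqr_ge0.
Qed.

(** The difference of the two sides is the square norm of [(f - g) - (g - h)]. *)
Lemma dot_dist_le (f g h : Omega -> R) : f \in Lfun P 2%:E ->
  g \in Lfun P 2%:E -> h \in Lfun P 2%:E ->
  dot (fun w => f w - h w) (fun w => f w - h w) <=
  2 * dot (fun w => f w - g w) (fun w => f w - g w)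
  + 2 * dot (fun w => g w - h w) (fun w => g w - h w).
Proof.
move=> f2 g2 h2; rewrite -subr_ge0.
have fg2 := Lfun2B f2 g2; have gh2 := Lfun2B g2 h2; have fh2 := Lfun2B f2 h2.
apply: le_trans (dot_ge0 P (fun w => (f w - g w) - (g w - h w))) _.
rewrite le_eqVlt; apply/orP; left; apply/eqP.
rewrite !dotBl ?Lfun2B// !dotBr ?Lfun2B//.
by rewrite (dotC _ g f) (dotC _ h f) (dotC _ h g); ring.
Qed.

(** Both integrals are first truncated at lower limits that differ by [T], then
    replaced by Riemann-Stieltjes sums over a partition and its translate. *)
Lemma improper_rs_integral_comb_limits F F' S T t X X' (i : 'I_p) :
  (forall u, S u \in Lfun P 2%:E) -> (forall v, F' (v + T) = F v) ->
  is_improper_rs_integral P F S t X ->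
  is_improper_rs_integral P F' S (t + T) X' ->
  comb_limits S T (fun w => X w i 0) (fun w => X' w i 0).
Proof.
move=> S2 FF' [X2 [V [VX XV]]] [X'2 [V' [VX' XV']]] eps eps0.
have e40 : 0 < eps / 4 by rewrite divr_gt0.
have near_dist (W : R -> Omega -> 'cV[R]_p) (Z : Omega -> 'cV[R]_p) :
    mean_square_dist P (W a) Z @[a --> -oo%R] --> 0%E ->
    \forall a \near -oo%R, (mean_square_dist P (W a) Z < (eps / 4)%:E)%E.
  move=> /fine_cvgP[fW /cvgrPdist_lt /(_ _ e40) dW]; near=> a.
  have fa : mean_square_dist P (W a) Z \is a fin_num by near: a.
  rewrite -(fineK fa) lte_fin; apply: le_lt_trans (ler_norm _) _.
  by rewrite -normrN -sub0r; near: a.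
have [M [_ MV]] := near_dist _ _ XV; have [M' [_ MV']] := near_dist _ _ XV'.
(* a truncation point at which both tails are small, before and after translation *)
pose a := Num.min t (Num.min M (M' - T)) - 1.
have am : a < Num.min t (Num.min M (M' - T)) by rewrite ltrBlDr ltrDl.
have at' : a < t by apply: lt_le_trans am _; rewrite ge_min lexx.
have aM : a < M by apply: lt_le_trans am _; rewrite !ge_min lexx orbT.
have aM' : a + T < M'.
  by rewrite -ltrBrDr; apply: lt_le_trans am _; rewrite !ge_min lexx !orbT.
have [Va2 Vrs] := VX _ at'.
have atT : a + T < t + T by rewrite ltrD2r.
have [V'a2 V'rs] := VX' _ atT.
have [d1 d10 H1] := Vrs _ e40; have [d2 d20 H2] := V'rs _ e40.
have d0 : 0 < Num.min d1 d2 by rewrite lt_min d10.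
have [u [xi Hu]] := uniform_partition at' d0.
have tagged_le (x y e e' : R) v z : e <= e' -> tagged_partition x y e v z ->
    tagged_partition x y e' v z.
  move=> ee' [pv Hv]; split=> // k kv; have [k1 k2] := Hv _ kv; split=> //.
  exact: lt_le_trans ee'.
exists (rs_comb F i a u xi).
rewrite -(shift_rs_comb _ _ _ _ FF').
set u' := map _ u; set xi' := fun k => xi k + T.
have rs2 (G : R -> 'cV[R]_p) b v z : square_integrable_vec P (rs_sum G S b v z).
  move=> j; rewrite (_ : (fun w => _) = increment_comb S (rs_comb G j b v z)).
    exact: increment_comb_Lfun2.
  by apply/funext => w; rewrite rs_sum_comb.
have half (W Z : Omega -> 'cV[R]_p) (G : R -> 'cV[R]_p) b v z :
    square_integrable_vec P W -> square_integrable_vec P Z ->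
    (mean_square_dist P (rs_sum G S b v z) W < (eps / 4)%:E)%E ->
    (mean_square_dist P W Z < (eps / 4)%:E)%E ->
    dot (fun w => increment_comb S (rs_comb G i b v z) w - Z w i 0)
        (fun w => increment_comb S (rs_comb G i b v z) w - Z w i 0) < eps.
  move=> W2 Z2 /(mean_square_dist_dot i (rs2 _ _ _ _) W2) dW.
  move=> /(mean_square_dist_dot i W2 Z2) dZ.
  have := dot_dist_le (rs2 G b v z i) (W2 i) (Z2 i).
  rewrite (_ : (fun w => increment_comb S _ w - _) =
    (fun w => rs_sum G S b v z w i 0 - Z w i 0)).
    by move=> H; apply: le_lt_trans H _; lra.
  by apply/funext => w; rewrite rs_sum_comb.
split.
- apply: (half (V a)) => //; last exact: MV.
  by apply: H1; apply: tagged_le Hu; rewrite ge_min lexx.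
- apply: (half (V' (a + T))) => //; last exact: MV'.
  apply: H2; apply: tagged_partition_shift.
  by apply: tagged_le Hu; rewrite ge_min lexx orbT.
Unshelve. all: by end_near. Qed.

End integrals.
End shift_invariance.

(** * The law of the number of atoms in an interval *)

Section intensity.
Context (R : realType) (r : nat) (s lambda : nat -> R) (ell : R -> R).
Hypotheses (Hblocks : periodic_blocks r s lambda)
           (Hell : periodic_intensity r s lambda ell).
Local Notation T := (period r s).

Lemma block_length_gt0 i : (0 < i)%N -> 0 < block_length s i.
Proof.
case: i => // i _; rewrite /block_length subr_gt0.
exact: (periodic_blocks_s_lt Hblocks).
Qed.

Lemma period_gt0 : 0 < T.
Proof.
rewrite /period big_nat_recl ?(periodic_blocks_r_gt0 Hblocks)//.
apply: ltr_wpDr; last exact: block_length_gt0.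
rewrite big_nat_cond; apply: sumr_ge0 => i _.
by rewrite ltW// block_length_gt0.
Qed.

Lemma intensity_periodicn n u : ell (u + n%:R * T) = ell u.
Proof.
elim: n => [|n IH]; first by rewrite mul0r addr0.
by rewrite -natr1 mulrDl mul1r addrA (periodic_intensity_periodic Hell).
Qed.

Lemma shift_gt0 u : exists n : nat, 0 < u + n%:R * T.
Proof.
exists (Num.truncn (- u / T)).+1.
by rewrite -ltrBlDl sub0r -ltr_pdivrMr ?period_gt0// truncnS_gt.
Qed.

(** Up to a translation by a multiple of [T] a point lies in a block, whose index
    can be reduced to [1..r]; the values on these finitely many blocks are
    bounded by their sum. *)
Lemma intensity_bounded : exists K, forall u, ell u <= K.
Proof.
exists (\sum_(1 <= j < r.+1) lambda j / block_length s j) => u.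
have [n un] := shift_gt0 u; rewrite -(intensity_periodicn n).
have r0 := periodic_blocks_r_gt0 Hblocks.
have : (`]0, +oo[%classic : set R) (u + n%:R * T) by rewrite /= in_itv/= un.
rewrite -(periodic_blocks_cover Hblocks) => -[i /= i0 bi].
rewrite (periodic_intensity_block Hell i0 bi).
pose j := ((i.-1 %% r).+1)%N; pose k := (i.-1 %/ r)%N.
have -> : i = (j + k * r)%N.
  by rewrite /j /k addSn addnC -divn_eq prednK.
rewrite (periodic_blocks_lambda Hblocks)// (periodic_blocks_length Hblocks)//.
rewrite (@bigD1_seq _ _ _ _ _ j) ?iota_uniq//=; last first.
  by rewrite mem_index_iota ltnS /j ltn_pmod.
rewrite lerDl big_nat_cond; apply: sumr_ge0 => l /andP[/andP[l0 _] _].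
rewrite divr_ge0// ltW// ?block_length_gt0//.
exact: (periodic_blocks_lambda_gt0 Hblocks).
Qed.

(** On the positive half-line the intensity is constant on each of countably many
    blocks; by periodicity the same holds on every half-line [(- n T, +oo)]. *)
Lemma intensity_measurable : measurable_fun setT ell.
Proof.
have pos : measurable_fun (`]0, +oo[%classic : set R) ell.
  rewrite -(periodic_blocks_cover Hblocks) bigcup_mkcond.
  apply/measurable_fun_bigcup => i.
    by case: ifPn => // _; exact: measurable_itv.
  case: ifPn => [|_]; last exact: measurable_fun_set0.
  rewrite inE/= => i0.
  apply: (eq_measurable_fun (cst (lambda i / block_length s i))) => //.
  by move=> u /[!inE] bu; rewrite /= (periodic_intensity_block Hell i0 bu).
have -> : [set: R] = \bigcup_n (`]- (n%:R * T), +oo[%classic).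
  apply/seteqP; split=> // u _; have [n un] := shift_gt0 u.
  by exists n => //=; rewrite in_itv/= andbT -subr_gt0 opprK.
apply/measurable_fun_bigcup => n; first exact: measurable_itv.
rewrite (_ : ell = ell \o (fun u => u + n%:R * T)).
  apply: (@measurable_comp _ _ _ _ _ _ (`]0, +oo[%classic : set R)) => //.
  - by move=> _ [u /= + <-]; rewrite !in_itv/= !andbT -subr_gt0 opprK.
  - by apply: measurable_funTS; apply: measurable_funD.
by apply/funext => u /=; rewrite intensity_periodicn.
Qed.

Lemma lebesgue_measureD (c : R) (A : set R) : measurable A ->
  pushforward lebesgue_measure
    ((fun x => x + c) : measurableTypeR R -> measurableTypeR R) A
  = lebesgue_measure A.
Proof.
move=> mA; apply/esym.
have mc : measurable_fun setT
    ((fun x => x + c) : measurableTypeR R -> measurableTypeR R).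
  exact: measurable_funD.
pose H := isMeasurableFun.Build _ _ _ _ _ mc.
pose f : {mfun measurableTypeR R >-> measurableTypeR R} :=
  HB.pack (fun x => x + c) H.
apply: (@lebesgue_measure_unique _ (pushforward lebesgue_measure f)) => //.
move=> _ [[a b]] _ <-.
rewrite -[RHS]/(lebesgue_measure ((fun x : R => x + c) @^-1` `]a, b]%classic)).
rewrite (_ : _ @^-1` _ = (`](a - c), (b - c)]%classic : set R)); last first.
  by apply/seteqP; split=> x /=; rewrite !in_itv/= ltrBlDr lerBrDr.
rewrite !lebesgue_measure_itv/= !lte_fin ltrD2r; case: ifPn => // _.
by rewrite -!EFinB; congr EFin; ring.
Qed.

Lemma mean_measure_shift a b :
  mean_measure ell `]a + T, b + T]%classic = mean_measure ell `]a, b]%classic.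
Proof.
pose phi : measurableTypeR R -> measurableTypeR R := fun x => x + T.
have mphi : measurable_fun setT phi by exact: measurable_funD.
rewrite /mean_measure.
transitivity (\int[pushforward lebesgue_measure phi]_(u in
    `](a + T)%R, (b + T)%R]) (ell u)%:E)%E.
  by apply: eq_measure_integral => A mA _; exact/esym/lebesgue_measureD.
rewrite ge0_integral_pushforward//=.
- rewrite (_ : _ @^-1` _ = `]a, b]%classic); last first.
    by apply/seteqP; split=> x /=; rewrite !in_itv/= ltrD2r lerD2r.
  by apply: eq_integral => u _ /=; rewrite (periodic_intensity_periodic Hell).
- apply/measurable_EFinP; apply: measurable_funTS; exact: intensity_measurable.
- by move=> u _; rewrite lee_fin ltW// (periodic_intensity_gt0 Hell).
Qed.

Lemma mean_measure_lty a b : (mean_measure ell `]a, b]%classic < +oo)%E.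
Proof.
have [K ellK] := intensity_bounded.
apply: (@le_lt_trans _ _ (\int[lebesgue_measure]_(u in `]a, b]) (cst K%:E) u)%E).
  apply: ge0_le_integral => //.
  - by move=> u _; rewrite lee_fin ltW// (periodic_intensity_gt0 Hell).
  - by apply/measurable_EFinP; apply: measurable_funTS; exact: intensity_measurable.
  - by move=> u _; rewrite lee_fin.
rewrite integral_cst//= [X in (_ * X)%E]lebesgue_measure_itv/=.
by case: ifPn => _; rewrite ?mule0// -EFinB -EFinM ltry.
Qed.

End intensity.

Section poisson_total_mass.
Context (R : realType).

Lemma poisson_mass_sum (m : R) : 0 <= m ->
  (\sum_(n <oo) (poisson_mass m n)%:E = 1)%E.
Proof.
move=> m0; rewrite [RHS](_ : _ = (expR (- m))%:E * (expR m)%:E)%E; last first.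
  by rewrite -EFinM expRN mulVf ?gt_eqF ?expR_gt0.
under eq_eseriesr.
  move=> n _; rewrite /poisson_mass -mulrA EFinM; over.
rewrite /= nneseriesZl/=; last first.
  by move=> n _; rewrite lee_fin divr_ge0// exprn_ge0.
congr *%E; rewrite expRE -EFin_lim; last first.
  rewrite /pseries/=; under eq_fun do rewrite mulrC.
  exact: is_cvg_series_exp_coeff.
apply/congr_lim/funext => n/=; rewrite /pseries/= /series/= -sumEFin//.
by under eq_bigr do rewrite mulrC.
Qed.

End poisson_total_mass.

(** * Recovering the labels of the atoms from counts *)

Section labels.
Context (R : realType).

Lemma counting_ge_fset (T : choiceType) (A : set T) (F : {fset T}) :
  [set` F] `<=` A -> (#|` F|%:R%:E <= counting A :> \bar R)%E.
Proof.
move=> FA; rewrite /counting; case: asboolP => [fA|_]; last exact: leey.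
rewrite lee_fin ler_nat; apply: fsubset_leq_card.
by rewrite -(set_fsetK F) -fset_set_sub.
Qed.

Lemma counting_le_fset (T : choiceType) (A : set T) (F : {fset T}) :
  A `<=` [set` F] -> (counting A <= #|` F|%:R%:E :> \bar R)%E.
Proof.
move=> AF; have fA : finite_set A by exact: sub_finite_set (finite_fset F).
rewrite /counting asboolT// lee_fin ler_nat; apply: fsubset_leq_card.
by rewrite -(set_fsetK F) -fset_set_sub.
Qed.

(** If a set only contains terms of a sequence and contains all the terms before
    any of its members, then its cardinal decides which terms it contains. *)
Lemma counting_initial (T : choiceType) (e : nat -> T) (A : set T) n :
  injective e -> A `<=` range e -> (forall i, A (e i.+1) -> A (e i)) ->
  A (e n) <-> (n.+1%:R%:E <= counting A :> \bar R)%E.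
Proof.
move=> einj Ae Adown.
have Adownle m k : (k <= m)%N -> A (e m) -> A (e k).
  elim: m => [|m IH]; first by rewrite leqn0 => /eqP ->.
  rewrite leq_eqVlt => /predU1P[->//|km] /Adown; exact: IH.
pose F m := [fset e i | i in iota 0 m]%fset.
have cF m : #|` F m| = m by rewrite card_imfset//= undup_id ?iota_uniq// size_iota.
have inF m k : (e k \in F m) = (k < m)%N.
  apply/imfsetP/idP => [[i /=]|km]; last by exists k; rewrite //= mem_iota.
  by move=> im /einj ->; move: (im : (i : nat) \in iota 0 m); rewrite mem_iota.
split=> [An|].
  rewrite -(cF n.+1); apply: counting_ge_fset => x /imfsetP[i /= im ->].
  apply: Adownle An; move: (im : (i : nat) \in iota 0 n.+1).
  by rewrite mem_iota.
move=> ngeA; apply: contrapT => nA.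
suff : (n.+1%:R%:E <= n%:R%:E :> \bar R)%E by rewrite lee_fin ler_nat ltnn.
apply: le_trans ngeA _; rewrite -(cF n); apply: counting_le_fset => x Ax.
have [k _ ekx] := Ae _ Ax; rewrite -ekx in Ax *; rewrite /= inF ltnNge.
by apply/negP => nk; apply: nA; exact: Adownle nk Ax.
Qed.

(** When [M] counts the points of a configuration numbered increasingly with
    [t 0 <= 0 < t 1], this says that the point with label [k] is at most [x]:
    for [k > 0] at least [k] points lie in [(0, x]]; for [k <= 0] fewer than
    [|k| + 1] points lie in [(x, 0]]. *)
Definition label_count (M : set R -> \bar R) (k : int) (x : R) : Prop :=
  if (0 < k) then (0 < x) /\ (`|k|%:R%:E <= M (`]0, x]%classic)%R)%E
  else 0 <= x \/ ~ ((`|k|.+1)%:R%:E <= M (`]x, 0]%classic)%R)%E.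

Lemma ordered_label_count (t : int -> R) (k : int) (x : R) :
  (forall j : int, t j < t (j + 1)) -> t 0 <= 0 < t 1 ->
  t k <= x <->
  label_count (fun A => counting [set j | A (t j)]) k x.
Proof.
move=> tS /andP[t0 t1].
have tn k' (n : nat) : t k' <= t (k' + n%:Z).
  elim: n => [|n IH]; first by rewrite addr0.
  have -> : k' + n.+1%:Z = k' + n%:Z + 1 by lia.
  exact: le_trans IH (ltW (tS _)).
have tmono i j : (i <= j) -> t i <= t j.
  move=> ij; have -> : j = i + `|j - i|%N%:Z by lia.
  exact: tn.
have tpos j : (0 < t j) = (0 < j).
  apply/idP/idP => [tj|j0]; last by apply: lt_le_trans t1 _; apply: tmono; lia.
  rewrite ltNge; apply/negP => j0; have := tmono _ _ j0.
  by move=> /le_trans/(_ t0); rewrite leNgt tj.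
rewrite /label_count; case: ifPn => k0.
  have [n ->] : exists n : nat, k = n.+1%:Z by exists `|k|%N.-1; lia.
  have ->: t n.+1%:Z <= x <-> [set j | `]0, x]%classic (t j)] n.+1%:Z.
    by rewrite /= in_itv/= tpos.
  rewrite (counting_initial (e := fun i => i.+1%:Z)).
  - split; last by case.
    move=> nM; split=> //; rewrite ltNge; apply/negP => x0; move: nM.
    rewrite (_ : [set j | _] = set0); last first.
      apply/seteqP; split=> // j /=; rewrite in_itv/= => /andP[tj tx].
      by have := lt_le_trans tj tx; rewrite ltNge x0.
    rewrite /counting asboolT// fset_set0 cardfs0 lee_fin.
    by rewrite ler_nat.
  - by move=> i j [].
  - move=> j /=; rewrite in_itv/= tpos => /andP[j0 _].
    by exists (`|j|.-1)%N => //; lia.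
  - move=> i /=; rewrite !in_itv/= !tpos => /andP[_ ti]; apply/andP; split=> //.
    by apply: le_trans ti; apply: tmono; lia.
have [n ->] : exists n : nat, k = - n%:Z by exists `|k|%N; lia.
have [x0|x0] := leP 0 x.
  split=> [_|_]; first by left.
  apply: le_trans x0; rewrite leNgt tpos; lia.
have -> : t (- n%:Z) <= x <-> ~ [set j | `]x, 0]%classic (t j)] (- n%:Z).
  rewrite /= in_itv/= leNgt; have -> : t (- n%:Z) <= 0 by rewrite leNgt tpos; lia.
  by rewrite andbT; split => /negP.
rewrite (counting_initial (e := fun i => - i%:Z)).
- by rewrite abszN; split=> [|[]//]; right.
- by move=> i j /oppr_inj[].
- move=> j /=; rewrite in_itv/= [_ <= 0]leNgt tpos => /andP[_ j0].
  by exists `|j|%N => //; lia.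
- move=> i /=; rewrite !in_itv/= ![_ <= 0]leNgt !tpos => /andP[xi _].
  apply/andP; split; last lia.
  by apply: lt_le_trans xi _; apply: tmono; lia.
Qed.

End labels.

(** * Independence and moments of the marks *)

Section independence_integrals.
Context d (Omega : measurableType d) (R : realType) (P : probability Omega R).

(** The tail formula [E X = \int_(r >= 0) P (X > r) dr] only sees events, so the
    product rule for events passes to the integral. *)
Lemma ge0_integral_indep (A : set Omega) (Z : Omega -> R) :
  measurable A -> measurable_fun setT Z -> (forall w, 0 <= Z w) ->
  (forall B : set R, measurable B ->
    P (Z @^-1` B `&` A) = (P (Z @^-1` B) * P A)%E) ->
  (\int[P]_(w in A) (Z w)%:E = (\int[P]_w (Z w)%:E) * P A)%E.
Proof.
move=> mA mZ Z0 ZA.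
pose ZA' w := Z w * \1_A w.
have mZA' : measurable_fun setT ZA'.
  by apply: measurable_funM => //; exact: measurable_indic.
pose Zm : {mfun Omega >-> R} := HB.pack Z (isMeasurableFun.Build _ _ _ _ _ mZ).
pose ZAm : {mfun Omega >-> R} :=
  HB.pack ZA' (isMeasurableFun.Build _ _ _ _ _ mZA').
have ZA'0 w : 0 <= ZAm w by rewrite /= /ZA' mulr_ge0.
have -> : (\int[P]_(w in A) (Z w)%:E = 'E_P[ZAm])%E.
  rewrite expectation_def integral_mkcond; apply: eq_integral => w _ /=.
  by rewrite /ZA' indicE patchE; case: ifPn => _; rewrite ?mulr1 ?mulr0.
rewrite (@ge0_expectation_ccdf _ _ _ P ZAm)//.
have -> : (\int[P]_w (Z w)%:E = 'E_P[Zm])%E by rewrite expectation_def.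
rewrite (@ge0_expectation_ccdf _ _ _ P Zm)//.
rewrite -ge0_integralZr//.
- apply: eq_integral => r0 /[!inE]/=; rewrite in_itv/= andbT => r00.
  rewrite /ccdf -[RHS]ZA//; congr (P _).
  apply/seteqP; split=> w /=; rewrite /ZA' !in_itv/= !andbT indicE.
    case: (boolP (w \in A)) => wA; rewrite ?mulr1 ?mulr0.
      by move=> rZ; split=> //; rewrite inE in wA.
    by rewrite ltNge r00.
  by move=> [rZ wA]; rewrite mem_set// mulr1.
- exact: measurable_funTS (ccdf_measurable Zm).
Qed.

Lemma ae_eq_measure (A B : set Omega) : measurable A -> measurable B ->
  {ae P, forall w, A w <-> B w} -> P A = P B.
Proof.
move=> mA mB AB; rewrite -[in LHS](setIT A) -[in RHS](setIT B) -!integral_indic//.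
apply: ae_eq_integral => //.
- by apply/measurable_EFinP; exact: measurable_indic.
- by apply/measurable_EFinP; exact: measurable_indic.
- apply: filterS AB => w AB _; congr EFin; rewrite !indicE.
  by congr (_%:R); congr nat_of_bool; apply/idP/idP; rewrite !inE => /AB.
Qed.

End independence_integrals.

Section iid_moments.
Context d (Omega : measurableType d) (R : realType) (P : probability Omega R).
Variables (tau J : int -> {RV P >-> R}) (J0 : {RV P >-> R}).
Hypothesis HJ : iid_marks tau J J0.

Lemma mark_sqr_integral k :
  (\int[P]_w (J k w ^+ 2)%:E = \int[P]_w (J0 w ^+ 2)%:E)%E.
Proof.
have E (X : {RV P >-> R}) : (\int[P]_w (X w ^+ 2)%:E =
    \int[distribution P X]_x (x ^+ 2)%:E)%E.
  rewrite (ge0_integral_distribution X (f := fun x => (x ^+ 2)%:E))//.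
  - by apply/measurable_EFinP; exact: measurable_funX.
  - by move=> x; rewrite lee_fin sqr_ge0.
rewrite !E; apply: eq_measure_integral => A mA _.
exact: iid_marks_law HJ k A mA.
Qed.

Lemma mark_Lfun2 k : (J k : Omega -> R) \in Lfun P 2%:E.
Proof.
apply/Lfun2P => //; rewrite mark_sqr_integral.
by apply/Lfun2P => //; exact: iid_marks_square_integrable HJ.
Qed.

Lemma dot_mark k : dot P (J k) (J k) = dot P J0 J0.
Proof.
rewrite /dot unlock; congr fine.
under eq_integral do rewrite -expr2.
by rewrite mark_sqr_integral; under [RHS]eq_integral do rewrite -expr2.
Qed.

Lemma dot_mark1 k : dot P (J k) (fun=> 1) = dot P J0 (fun=> 1).
Proof.
have sub : {subset Lfun P 2%:E <= Lfun P 1}.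
  by apply: Lfun_subset12; exact: fin_num_measure.
have E (X : {RV P >-> R}) : (X : Omega -> R) \in Lfun P 2%:E ->
    dot P X (fun=> 1) = fine (\int[distribution P X]_x x%:E)%E.
  move=> /sub/Lfun1_integrable iX.
  rewrite (integral_distribution (X := X) (f := EFin) _ iX)//.
  rewrite /dot unlock; congr fine.
  by apply: eq_integral => w _ /=; rewrite mulr1.
rewrite !E//; last 2 first.
- exact: iid_marks_square_integrable HJ.
- exact: mark_Lfun2.
congr fine; apply: eq_measure_integral => A mA _.
exact: iid_marks_law HJ k A mA.
Qed.

(** Two distinct marks have the product law, whatever their labels. *)
Lemma dot_mark_neq k l : k != l ->
  dot P (J k) (J l) = fine (\int[(distribution P J0 \x distribution P J0)%E]_x
    (x.1 * x.2)%:E)%E.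
Proof.
move=> kl; pose phi w := (J k w, J l w).
have mphi : measurable_fun setT phi by exact: measurable_fun_pair.
pose f : {mfun Omega >-> (R * R)%type} :=
  HB.pack phi (isMeasurableFun.Build _ _ _ _ _ mphi).
have prodE A : measurable A ->
    (distribution P J0 \x distribution P J0)%E A = distribution P f A.
  apply: product_measure_unique => B C mB mC.
  have := iid_marks_independent HJ (s := [:: k; l])
    (B := fun i => if i == k then B else C).
  rewrite /= inE kl => /(_ isT) h.
  have {h} := h _ _; rewrite big_cons big_seq1 eqxx.
  have lk : l == k = false by apply/negbTE; rewrite eq_sym.
  rewrite lk -(iid_marks_law HJ k mB) -(iid_marks_law HJ l mC) => <-.
  - rewrite /distribution /pushforward/=; congr (P _).
    apply/seteqP; split=> w /=.
      move=> [Bw Cw] i /=; rewrite !inE => /orP[] /eqP ->; first by rewrite eqxx.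
      by rewrite lk.
    move=> H; split; first by have := H k; rewrite /= !inE eqxx => /(_ isT).
    by have := H l; rewrite /= !inE eqxx orbT lk => /(_ isT).
  - by [].
  - by move=> i; case: ifP.
have -> : (\int[(distribution P J0 \x distribution P J0)%E]_x (x.1 * x.2)%:E
    = \int[distribution P f]_x (x.1 * x.2)%:E)%E.
  by apply: eq_measure_integral => A mA _; exact: prodE.
have mm : measurable_fun setT (fun x : R * R => (x.1 * x.2)%:E).
  by apply/measurable_EFinP; exact: measurable_funM.
rewrite (integral_distribution (X := f) (f := fun x : R * R => (x.1 * x.2)%:E))//.
  by rewrite /dot unlock.
apply/Lfun1_integrable; apply: Lfun2_mul_Lfun1; exact: mark_Lfun2.
Qed.

(** Expanding the square, the diagonal terms, the off-diagonal terms and the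
    linear terms have expectations that are the same for all labels, so only
    their numbers matter. *)
Lemma mark_sum_sqr (c : R) : exists h : nat -> R, forall F : {fset int},
  let Z w := \sum_(k <- F) J k w + c in
  (\int[P]_w (Z w ^+ 2)%:E = (h #|` F|)%:E)%E.
Proof.
pose m2 := dot P J0 J0; pose m1 := dot P J0 (fun=> 1).
pose m11 := fine (\int[(distribution P J0 \x distribution P J0)%E]_x
    (x.1 * x.2)%:E)%E.
exists (fun n => (n%:R * m2 + n%:R * n.-1%:R * m11) + 2 * c * (n%:R * m1) + c ^+ 2).
move=> F Z.
have JF2 : (fun w => \sum_(k <- F) J k w) \in Lfun P 2%:E.
  by apply: Lfun2_sum => k; exact: mark_Lfun2.
have c2 := Lfun2_cst P c; have one2 := Lfun2_cst P 1.
transitivity (dot P Z Z)%:E.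
  rewrite -dotE; [|exact: Lfun2D..].
  by rewrite unlock; apply: eq_integral => w _; rewrite expr2.
congr EFin; have cst_dot X : X \in Lfun P 2%:E ->
    dot P X (fun=> c) = c * dot P X (fun=> 1).
  by move=> X2; rewrite -dotZr//; congr dot; apply/funext => w; rewrite mulr1.
rewrite /Z dotDl ?Lfun2D// !dotDr//.
rewrite (dotC P (fun=> c)) !cst_dot// (dotC P (fun=> c)) cst_dot//.
have -> : dot P (fun=> 1) (fun=> 1) = 1.
  by rewrite /dot; under eq_fun do rewrite mulr1; rewrite expectation_cst.
have -> : dot P (fun w => \sum_(k <- F) J k w) (fun=> 1) = #|` F|%:R * m1.
  rewrite dot_suml//; last by move=> k; exact: mark_Lfun2.
  under eq_bigr do rewrite dot_mark1.
  by rewrite big_const_seq count_predT iter_addr addr0 mulr_natl.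
have -> : dot P (fun w => \sum_(k <- F) J k w) (fun w => \sum_(k <- F) J k w)
    = #|` F|%:R * m2 + #|` F|%:R * #|` F|.-1%:R * m11.
  rewrite dot_suml//; last by move=> k; exact: mark_Lfun2.
  transitivity (\sum_(k <- F) (m2 + #|` F|.-1%:R * m11)).
    apply: eq_big_seq => k kF.
    rewrite dot_sumr; [|by move=> l; exact: mark_Lfun2|exact: mark_Lfun2].
    rewrite (bigD1_seq k)//= dot_mark; congr (_ + _).
    transitivity (\sum_(l <- F | l != k) m11).
      by apply: eq_bigr => l lk; rewrite dot_mark_neq// eq_sym.
    rewrite big_const_seq iter_addr addr0 mulr_natl; congr (_ *+ _).
    have := count_predC (pred1 k) F.
    rewrite count_uniq_mem// kF add1n => /(congr1 predn) /= <-.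
    by [].
  by rewrite big_const_seq count_predT iter_addr addr0 -[LHS]mulr_natl mulrDr mulrA.
ring.
Qed.

End iid_moments.

(** * The events on which the labels of the atoms in an interval are known *)

Section countable_measurability.
Context d (T : measurableType d).

Lemma bigcap_countType_measurable (K : countType) (D : K -> set T) :
  (forall i, measurable (D i)) -> measurable (\bigcap_i D i).
Proof.
move=> mD; rewrite (_ : \bigcap_i D i =
    \bigcap_n (if @choice.unpickle K n is Some i then D i else setT)).
  by apply: bigcapT_measurable => n; case: choice.unpickle.
apply/seteqP; split=> x H => [n _|i _].
  by case: choice.unpickle => // i; exact: H.
by have := H (choice.pickle i) I; rewrite choice.pickleK.
Qed.

End countable_measurability.

Lemma sigma_of_measurable_fun d (Omega : measurableType d) (I : Type) d'
    (E : measurableType d') (D : set I) (X : I -> Omega -> E) i : D i ->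
  measurable_fun (setT : set (g_sigma_algebraType
    (\bigcup_(i in D) preimage_set_system setT (X i) measurable))) (X i).
Proof.
move=> Di _ B mB; apply: sub_gen_smallest; exists i => //; exists B => //.
Qed.

Section labelled_events.
Context d (Omega : measurableType d) (R : realType) (P : probability Omega R).
Variables (tau : int -> {RV P >-> R}).
Local Notation M := (point_measure tau).
Local Notation sigmaM := (sigma_of [set A : set R | measurable A] M).

Definition atoms_event (a b : R) (F : {fset int}) : set Omega :=
  [set w | [set k | a < tau k w <= b] = [set` F]].

(** Almost surely the same event, but read off from counts: it lies in the
    sigma-algebra generated by the random measure, where the numbering of the
    atoms need not be measurable on the exceptional null set. *)
Definition count_event (a b : R) (F : {fset int}) : set Omega :=
  \bigcap_(k in [set: int])
    (if k \in F then [set w | label_count (M ^~ w) k b /\ ~ label_count (M ^~ w) k a]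
     else ~` [set w | label_count (M ^~ w) k b /\ ~ label_count (M ^~ w) k a]).

Lemma atoms_eventE a b F : atoms_event a b F =
  \bigcap_(k in [set: int]) (if k \in F then tau k @^-1` `]a, b]%classic
                           else ~` (tau k @^-1` `]a, b]%classic)).
Proof.
apply/seteqP; split=> w.
  move=> /= wF k _; have E : (a < tau k w <= b) <-> k \in F.
    by rewrite -[X in X <-> _]/([set k | a < tau k w <= b] k) wF.
  case: ifPn => kF; rewrite /= in_itv/=; first exact: (proj2 E).
  by move/(proj1 E); rewrite (negbTE kF).
move=> H; apply/seteqP; split=> k /=.
  have := H k I; case: ifPn => // kF; rewrite /= in_itv/=.
by move=> kF; have := H k I; rewrite kF /= in_itv.
Qed.

Lemma measurable_atoms_event a b F : measurable (atoms_event a b F).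
Proof.
rewrite atoms_eventE; apply: bigcap_countType_measurable => k.
have m : measurable (tau k @^-1` `]a, b]%classic).
  by rewrite -[X in measurable X]setTI; exact: measurable_funP.
by case: ifP => // _; exact: measurableC.
Qed.

Lemma sigmaM_label_count k x : sigmaM [set w | label_count (M ^~ w) k x].
Proof.
pose U := g_sigma_algebraType
  (\bigcup_(A in [set A : set R | measurable A])
     preimage_set_system setT (M A) measurable).
have ge_event (A : set R) (c : R) : measurable A ->
    @measurable _ U [set w | (c%:E <= M A w)%E].
  move=> mA; have mM : measurable_fun (setT : set U) (M A).
    exact: sigma_of_measurable_fun.
  have -> : [set w | (c%:E <= M A w)%E] = setT `&` M A @^-1` `[c%:E, +oo[%classic.
    by apply/seteqP; split=> w /=; rewrite in_itv/= andbT => // -[].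
  by apply: mM => //; exact: emeasurable_itv.
suff : @measurable _ U [set w | label_count (M ^~ w) k x] by [].
have m0 : @measurable _ U set0 by exact: measurable0.
have mT : @measurable _ U setT by exact: measurableT.
have [k0|/negbTE k0] := boolP (0 < k).
  have [x0|/negbTE x0] := boolP (0 < x).
    rewrite (_ : [set w | label_count (M ^~ w) k x] =
        [set w | (`|k|%:R%:E <= M (`]0%R, x]%classic) w)%E]); first exact: ge_event.
    by apply/seteqP; split=> w; rewrite /= /label_count k0 x0 => // -[].
  rewrite (_ : [set w | label_count (M ^~ w) k x] = set0); first exact: m0.
  by apply/seteqP; split=> w //=; rewrite /label_count k0 x0 => -[].
have [x0|/negbTE x0] := boolP (0 <= x).
  rewrite (_ : [set w | label_count (M ^~ w) k x] = setT); first exact: mT.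
  by apply/seteqP; split=> w //= _; rewrite /label_count k0 x0; left.
rewrite (_ : [set w | label_count (M ^~ w) k x] =
    ~` [set w | (`|k|.+1%:R%:E <= M (`]x, 0%R]%classic) w)%E]).
  by apply: measurableC; exact: ge_event.
apply/seteqP; split=> w; rewrite /= /label_count k0 x0; last by right.
by case.
Qed.

Lemma sigmaM_count_event a b F : sigmaM (count_event a b F).
Proof.
pose U := g_sigma_algebraType
  (\bigcup_(A in [set A : set R | measurable A])
     preimage_set_system setT (M A) measurable).
suff : @measurable _ U (count_event a b F) by [].
apply: bigcap_countType_measurable => k.
have m : @measurable _ U
    [set w | label_count (M ^~ w) k b /\ ~ label_count (M ^~ w) k a].
  have -> : [set w | label_count (M ^~ w) k b /\ ~ label_count (M ^~ w) k a]
    = [set w | label_count (M ^~ w) k b] `&`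
      ~` [set w | label_count (M ^~ w) k a] by [].
  apply: measurableI; first exact: sigmaM_label_count.
  by apply: measurableC; exact: sigmaM_label_count.
by case: ifP => // _; exact: measurableC.
Qed.

Lemma atoms_event_count a b F w :
  (forall k : int, tau k w < tau (k + 1) w) -> tau 0 w <= 0 < tau 1 w ->
  atoms_event a b F w <-> count_event a b F w.
Proof.
move=> tS t01; have L k x := ordered_label_count k x tS t01.
have E k : `]a, b]%classic (tau k w) <->
    label_count (M ^~ w) k b /\ ~ label_count (M ^~ w) k a.
  rewrite -!L /= in_itv/=; split=> [/andP[ak kb]|[kb /negP ak]].
    by split=> //; apply/negP; rewrite -ltNge.
  by rewrite kb ltNge ak.
rewrite atoms_eventE; split=> H k _; have := H k I; case: ifPn => kF /=.
- by move/E.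
- by move=> nk /E.
- by move/E.
- by move=> nk /E.
Qed.

End labelled_events.

(** * Second moments of the increments *)

Section compound_poisson.
Context d (Omega : measurableType d) (R : realType) (P : probability Omega R).
Variables (r : nat) (s lambda : nat -> R) (ell : R -> R).
Hypotheses (Hblocks : periodic_blocks r s lambda)
           (Hell : periodic_intensity r s lambda ell).
Variables (tau J : int -> {RV P >-> R}) (J0 : {RV P >-> R}).
Hypotheses (Htau : poisson_atoms ell tau) (HJ : iid_marks tau J J0).
Variables (gamma : R) (S : R -> {RV P >-> R}).
Hypothesis HS : second_order_subordinator gamma tau J S.
Local Notation T := (period r s).
Local Notation M := (point_measure tau).

Definition number_event (a b : R) (n : nat) : set Omega :=
  [set w | M `]a, b]%classic w = n%:R%:E].

Lemma measurable_number_event a b n : measurable (number_event a b n).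
Proof.
have mM := prm_measurable (poisson_atoms_prm Htau) (measurable_itv `]a, b]).
rewrite (_ : number_event a b n = setT `&` M `]a, b]%classic @^-1` [set n%:R%:E]).
  by apply: mM => //; exact: emeasurable_set1.
by apply/seteqP; split=> w //= -[].
Qed.

Lemma number_event_prob a b n : P (number_event a b n) =
  (poisson_mass (fine (mean_measure ell `]a, b]%classic)) n)%:E.
Proof.
apply: (prm_poisson (poisson_atoms_prm Htau)); first exact: measurable_itv.
exact: mean_measure_lty Hblocks Hell _ _.
Qed.

Lemma number_event_shift a b n :
  P (number_event (a + T) (b + T) n) = P (number_event a b n).
Proof. by rewrite !number_event_prob (mean_measure_shift Hblocks Hell). Qed.

Lemma trivIset_number_event a b : trivIset setT (number_event a b).
Proof.
move=> m n _ _ [w /= [Mm Mn]]; apply/eqP.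
by have := Mn; rewrite /number_event/= Mm => -[] /eqP; rewrite eqr_nat.
Qed.

(** Almost surely the interval contains finitely many atoms, since the Poisson
    masses sum to one. *)
Lemma number_event_total a b : P (~` \bigcup_n number_event a b n) = 0%E.
Proof.
have mE := bigcupT_measurable _ (measurable_number_event a b).
rewrite probability_setC// measure_semi_bigcup//; last 2 first.
- exact: measurable_number_event.
- exact: trivIset_number_event.
rewrite (eq_eseriesr (g := fun n =>
  (poisson_mass (fine (mean_measure ell `]a, b]%classic)) n)%:E)); last first.
  by move=> n _; exact: number_event_prob.
rewrite poisson_mass_sum ?subee//.
apply: fine_ge0; apply: integral_ge0 => u _.
by rewrite lee_fin ltW// (periodic_intensity_gt0 Hell).
Qed.

Lemma number_eventE a b n : number_event a b n =
  \bigcup_(F in [set F : {fset int} | #|` F| = n]) atoms_event tau a b F.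
Proof.
have E w : [set k | `]a, b]%classic (tau k w)] = [set k | a < tau k w <= b].
  by apply/seteqP; split=> k /=; rewrite in_itv.
apply/seteqP; split=> w /=.
  rewrite /number_event/= /point_measure E /counting.
  case: asboolP => // fI [] /eqP; rewrite eqr_nat => /eqP In.
  exists (fset_set [set k | a < tau k w <= b]) => //=.
  by rewrite /atoms_event/= fset_setK.
move=> [F /= Fn]; rewrite /atoms_event/= => IF.
by rewrite /number_event/= /point_measure E IF /counting asboolT// set_fsetK Fn.
Qed.

Lemma atoms_event_jump_sum a b F w : atoms_event tau a b F w ->
  jump_sum (fun k => tau k) (fun k => J k) a b w = \sum_(k <- F) J k w.
Proof.
by rewrite /jump_sum => ->; rewrite fsbig_finite//= set_fsetK.
Qed.

Lemma measurable_increment_sqr a b c : measurable_fun setT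
  (fun w => (S b w - S a w - gamma * (b - a) + c) ^+ 2).
Proof.
apply: measurable_funX; apply: measurable_funD => //.
by apply: measurable_funB => //; exact: measurable_funB.
Qed.

(** On the event [I = F] the increment is almost surely an explicit function of the
    marks with labels in [F], and that event is independent of the marks. *)
Lemma integral_atoms_event a b c F : a < b ->
  (\int[P]_(w in atoms_event tau a b F)
     ((S b w - S a w - gamma * (b - a) + c) ^+ 2)%:E
   = (\int[P]_w ((\sum_(k <- F) J k w + c) ^+ 2)%:E) * P (atoms_event tau a b F))%E.
Proof.
move=> ab.
have mG := measurable_atoms_event tau a b F.
have mS := measurable_increment_sqr a b c.
have mZ : measurable_fun setT (fun w => (\sum_(k <- F) J k w + c) ^+ 2).
  apply: measurable_funX; apply: measurable_funD => //.
  by apply: measurable_sum => k; exact: measurable_funP.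
transitivity (\int[P]_(w in atoms_event tau a b F)
     ((\sum_(k <- F) J k w + c) ^+ 2)%:E)%E.
  apply: ae_eq_integral => //.
  - by apply/measurable_EFinP; exact: measurable_funTS.
  - by apply/measurable_EFinP; exact: measurable_funTS.
  apply: filterS (sos_path HS) => w [_ path] Gw.
  rewrite (path _ _ ab) (atoms_event_jump_sum Gw); congr EFin; congr (_ ^+ 2).
  ring.
apply: ge0_integral_indep => //.
  by move=> w; rewrite sqr_ge0.
move=> B mB; set Z := fun w => _.
have sJ : sigma_of setT J (Z @^-1` B).
  pose U := g_sigma_algebraType
    (\bigcup_(k in [set: int])
       preimage_set_system setT (J k : Omega -> R) measurable).
  have mZU : measurable_fun (setT : set U) Z.
    apply: measurable_funX; apply: measurable_funD => //.
    apply: measurable_sum => k.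
    exact: (sigma_of_measurable_fun (X := fun k => J k : Omega -> R)).
  suff : @measurable _ U (Z @^-1` B) by [].
  by rewrite -[X in measurable X]setTI; exact: mZU.
have mZB : measurable (Z @^-1` B).
  by rewrite -[X in measurable X]setTI; exact: mZ.
have mC : measurable (count_event tau a b F).
  have := sigmaM_count_event (tau := tau) a b F.
  apply: smallest_sub; first exact: sigma_algebra_measurable.
  move=> _ [A mA [C mC <-]]; rewrite setTI.
  rewrite -[X in measurable X]setTI.
  exact: (prm_measurable (poisson_atoms_prm Htau)).
have ae_ord := poisson_atoms_ordered Htau.
have GC : {ae P, forall w, atoms_event tau a b F w <-> count_event tau a b F w}.
  by apply: filterS ae_ord => w [? ?]; exact: atoms_event_count.
rewrite (ae_eq_measure mG mC GC).
have := iid_marks_independent_atoms HJ sJ (sigmaM_count_event (tau := tau) a b F).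
move=> <-; apply: ae_eq_measure; [exact: measurableI..|].
by apply: filterS GC => w GCw; rewrite /setI/= GCw.
Qed.
(** Nonnegativity is built in by a maximum with 0, which changes no value at the
    cardinal of a finite set. *)
Lemma ge0_mark_sum_sqr c : exists h : nat -> R, (forall n, 0 <= h n) /\
  forall F : {fset int},
    (\int[P]_w ((\sum_(k <- F) J k w + c) ^+ 2)%:E = (h #|` F|)%:E)%E.
Proof.
have [h hE] := mark_sum_sqr HJ c.
exists (fun n => Num.max 0 (h n)); split=> [n|F]; first by rewrite le_max lexx.
rewrite hE; congr EFin; apply/esym/max_idPr; rewrite -lee_fin -hE.
by apply: integral_ge0 => w _; rewrite lee_fin sqr_ge0.
Qed.

Lemma integral_number_event a b c n (h : nat -> R) : a < b ->
  (forall n, 0 <= h n) ->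
  (forall F : {fset int},
    (\int[P]_w ((\sum_(k <- F) J k w + c) ^+ 2)%:E = (h #|` F|)%:E)%E) ->
  (\int[P]_(w in number_event a b n)
     ((S b w - S a w - gamma * (b - a) + c) ^+ 2)%:E
   = (h n)%:E * P (number_event a b n))%E.
Proof.
move=> ab hge0 hE.
(* pickle_inv rather than unpickle: the former reaches each F only once. *)
pose D i := if @choice.pickle_inv {fset int} i is Some F then
  (if #|` F| == n then atoms_event tau a b F else set0) else set0.
have mD i : measurable (D i).
  rewrite /D; case: choice.pickle_inv => // F; case: ifP => // _.
  exact: measurable_atoms_event.
have DE : number_event a b n = \bigcup_i D i.
  rewrite number_eventE; apply/seteqP; split=> w.
    move=> [F /= Fn wF]; exists (choice.pickle F) => //.
    by rewrite /D choice.pickleK_inv Fn eqxx.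
  move=> [i _]; rewrite /D; case: choice.pickle_inv => // F.
  by case: ifP => // /eqP Fn wF; exists F.
have tD : trivIset setT D.
  move=> i j _ _ [w []]; rewrite /D.
  case Fi : (choice.pickle_inv i) => [F|//]; case: ifP => // _ wF.
  case Gj : (choice.pickle_inv j) => [G|//]; case: ifP => // _ wG.
  have FG : F = G.
    rewrite /atoms_event/= in wF wG.
    by rewrite -(set_fsetK F) -(set_fsetK G) -wF wG.
  have := @choice.pickle_invK {fset int} i.
  have := @choice.pickle_invK {fset int} j.
  by rewrite Fi Gj /= FG => -> ->.
have mS := measurable_increment_sqr a b c.
rewrite DE ge0_integral_bigcup//; last 2 first.
- by apply/measurable_EFinP; exact: measurable_funTS.
- by move=> w _; rewrite lee_fin sqr_ge0.
rewrite measure_semi_bigcup//; last exact: bigcupT_measurable.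
rewrite -nneseriesZl//; apply: eq_eseriesr => i _.
rewrite /D; case: choice.pickle_inv => [F|]; last first.
  by rewrite integral_set0 measure0 mule0.
case: ifP => [/eqP Fn|_]; last by rewrite integral_set0 measure0 mule0.
by rewrite integral_atoms_event// hE Fn.
Qed.

(** The integral splits over the value [n] of the number of atoms; the
    resulting series only depends on the law of that number. *)
Lemma integral_increment_sqr a b c (h : nat -> R) : a < b ->
  (forall n, 0 <= h n) ->
  (forall F : {fset int},
    (\int[P]_w ((\sum_(k <- F) J k w + c) ^+ 2)%:E = (h #|` F|)%:E)%E) ->
  (\int[P]_w ((S b w - S a w - gamma * (b - a) + c) ^+ 2)%:E
   = \sum_(n <oo) (h n)%:E * P (number_event a b n))%E.
Proof.
move=> ab hge0 hE.
have mS := measurable_increment_sqr a b c.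
have mE : measurable (\bigcup_n number_event a b n).
  by apply: bigcupT_measurable => n; exact: measurable_number_event.
rewrite (ge0_negligible_integral (measurableC mE))//; last 3 first.
- exact/measurable_EFinP.
- by move=> w _; rewrite lee_fin sqr_ge0.
- exact: number_event_total.
rewrite setTD setCK ge0_integral_bigcup//; last 4 first.
- exact: measurable_number_event.
- by apply/measurable_EFinP; exact: measurable_funTS.
- by move=> w _; rewrite lee_fin sqr_ge0.
- exact: trivIset_number_event.
by apply: eq_eseriesr => n _; exact: integral_number_event.
Qed.

Lemma integral_increment_sqr_shift a b c : a < b ->
  (\int[P]_w ((S (b + T)%R w - S (a + T)%R w + c) ^+ 2)%:E
   = \int[P]_w ((S b w - S a w + c) ^+ 2)%:E)%E.
Proof.
move=> ab; have [h [hge0 hE]] := ge0_mark_sum_sqr (c + gamma * (b - a)).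
have E x y : x < y -> y - x = b - a ->
    (\int[P]_w ((S y w - S x w + c) ^+ 2)%:E
     = \sum_(n <oo) (h n)%:E * P (number_event x y n))%E.
  move=> xy yx; rewrite -(integral_increment_sqr xy hge0 hE).
  by apply: eq_integral => w _; rewrite yx; congr EFin; congr (_ ^+ 2); ring.
have abT : a + T < b + T by rewrite ltrD2r.
have TT : b + T - (a + T) = b - a by rewrite opprD addrACA subrr addr0.
rewrite (E a b ab erefl) (E _ _ abT TT).
by apply: eq_eseriesr => n _; rewrite number_event_shift.
Qed.

Let S2 t : (S t : Omega -> R) \in Lfun P 2%:E.
Proof. exact: sos_square_integrable HS t. Qed.

Let dot_incr a b c :
  dot P (fun w => S b w - S a w + c) (fun w => S b w - S a w + c)
  = fine (\int[P]_w ((S b w - S a w + c) ^+ 2)%:E)%E.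
Proof.
by rewrite /dot unlock; congr fine; apply: eq_integral => w _; rewrite expr2.
Qed.

Let dot_incrD a b c :
  dot P (fun w => S b w - S a w + c) (fun w => S b w - S a w + c)
  = dot P (fun w => S b w - S a w) (fun w => S b w - S a w)
    + 2 * c * dot P (fun w => S b w - S a w) (fun=> 1) + c ^+ 2.
Proof.
have D2 := Lfun2B (S2 b) (S2 a).
have c2 := Lfun2_cst P c; have one2 := Lfun2_cst P 1.
have cst_dot X : X \in Lfun P 2%:E ->
    dot P X (fun=> c) = c * dot P X (fun=> 1).
  by move=> X2; rewrite -dotZr//; congr dot; apply/funext => w; rewrite mulr1.
have Dc2 := Lfun2D D2 c2.
rewrite (dotDl D2 c2 Dc2) (dotDr D2 c2 D2) (dotDr D2 c2 c2).
rewrite (dotC P (fun=> c)) !cst_dot// (dotC P (fun=> c)) cst_dot//.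
have -> : dot P (fun=> 1) (fun=> 1) = 1.
  by rewrite /dot; under eq_fun do rewrite mulr1; rewrite expectation_cst.
ring.
Qed.

Let incr_shift a b c : a < b ->
  dot P (fun w => S (b + T) w - S (a + T) w + c)
        (fun w => S (b + T) w - S (a + T) w + c)
  = dot P (fun w => S b w - S a w + c) (fun w => S b w - S a w + c).
Proof. by move=> ab; rewrite !dot_incr integral_increment_sqr_shift. Qed.

Let dot_opp a b : dot P (fun w => S b w - S a w) (fun w => S b w - S a w) =
  dot P (fun w => S a w - S b w) (fun w => S a w - S b w).
Proof.
by rewrite !dotBl ?Lfun2B// !dotBr// (dotC P (S b) (S a)); ring.
Qed.

Let dot_opp1 a b : dot P (fun w => S b w - S a w) (fun=> 1) =
  - dot P (fun w => S a w - S b w) (fun=> 1).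
Proof. by rewrite !dotBl ?Lfun2_cst// opprB. Qed.

Lemma increment_sqr_shift a b :
  dot P (fun w => S (b + T) w - S (a + T) w) (fun w => S (b + T) w - S (a + T) w)
  = dot P (fun w => S b w - S a w) (fun w => S b w - S a w).
Proof.
have lt x y : x < y ->
    dot P (fun w => S (y + T) w - S (x + T) w) (fun w => S (y + T) w - S (x + T) w)
    = dot P (fun w => S y w - S x w) (fun w => S y w - S x w).
  move=> xy; have := incr_shift 0 xy; rewrite !dot_incrD.
  by rewrite mulr0 !mul0r expr0n /= !addr0.
have [ab|ba|->] := ltgtP a b; first exact: lt.
  by rewrite dot_opp lt// dot_opp.
by rewrite !dotBl ?Lfun2B// !subrr.
Qed.

(** The second moments of [Delta] and of [Delta + 1] determine the mean of
    [Delta]. *)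
Lemma increment_mean_shift a b :
  dot P (fun w => S (b + T) w - S (a + T) w) (fun=> 1)
  = dot P (fun w => S b w - S a w) (fun=> 1).
Proof.
have lt x y : x < y ->
    dot P (fun w => S (y + T) w - S (x + T) w) (fun=> 1)
    = dot P (fun w => S y w - S x w) (fun=> 1).
  move=> xy; have := incr_shift 1 xy; rewrite !dot_incrD increment_sqr_shift.
  by move=> /addIr/addrI; rewrite mulr1 => /mulfI; apply; rewrite pnatr_eq0.
have [ab|ba|->] := ltgtP a b; first exact: lt.
  by rewrite dot_opp1 lt// -dot_opp1.
by rewrite !dotBl ?Lfun2_cst// !subrr.
Qed.

End compound_poisson.

(** * Covariances of the process *)

Theorem lemma4p2 (R : realType) (d : measure_display)
  (Omega : measurableType d) (P : probability Omega R)
  (r : nat) (s lambda : nat -> R) (Hblocks : periodic_blocks r s lambda)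
  (ell : R -> R) (Hell : periodic_intensity r s lambda ell)
  (tau : int -> {RV P >-> R}) (Htau : poisson_atoms ell tau)
  (J : int -> {RV P >-> R}) (J0 : {RV P >-> R}) (HJ : iid_marks tau J J0)
  (gamma : R) (S : R -> {RV P >-> R})
  (HS : second_order_subordinator gamma tau J S)
  (p q : nat) (a b : nat -> R) (Hcarma : carma_coefficients p q a b)
  (HA : eigenvalues_negative_real_part (carma_A p a))
  (X : R -> Omega -> 'cV[R]_p)
  (HX : forall t : R, is_improper_rs_integral P
    (fun u => expm ((t - u) *: carma_A p a) *m carma_e R p) S t (X t))
  (HXindep : forall t : R, independent_sigma P
    (sigma_of setT (fun (i : 'I_p) w => X t w i 0))
    (sigma_of [set v : R | t < v] (fun v w => S v w - S t w))) :
  let T := period r s in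
  let Y := fun (t : R) (w : Omega) => ((carma_b p b)^T *m X t w) 0 0 in
  (forall t h : R, 0 < h ->
    covariance_mx P (X (t + T)) (X (t + h + T))
    = covariance_mx P (X t) (X (t + h))) /\
  weakly_periodically_stationary P T Y.
Proof.
move=> T Y.
have S2 t : (S t : Omega -> R) \in Lfun P 2%:E by exact: sos_square_integrable HS t.
have Smean := increment_mean_shift Hblocks Hell Htau HJ HS.
have Ssqr := increment_sqr_shift Hblocks Hell Htau HJ HS.
have X2 t i : (fun w => X t w i 0) \in Lfun P 2%:E by have [+ _] := HX t; exact.
have Xcomb t i : comb_limits P (fun u => S u) T
    (fun w => X t w i 0) (fun w => X (t + T) w i 0).
  apply: (improper_rs_integral_comb_limits i S2 _ (HX t) (HX (t + T))) => v.
  by have -> : t + T - (v + T) = t - v by rewrite opprD addrACA subrr addr0.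
have Xdot t v i j : dot P (fun w => X (t + T) w i 0) (fun w => X (v + T) w j 0)
    = dot P (fun w => X t w i 0) (fun w => X v w j 0).
  exact: (comb_limits_dot S2 Ssqr).
have Xmean t i : dot P (fun w => X (t + T) w i 0) (fun=> 1)
    = dot P (fun w => X t w i 0) (fun=> 1).
  exact: (comb_limits_mean S2 Smean).
split.
  move=> t h _; apply/matrixP => i j; rewrite !mxE !covariance_dot//.
  by rewrite Xdot !Xmean.
have YE t : Y t = fun w => \sum_(i < p) b i * X t w i 0.
  by apply/funext => w; rewrite /Y mxE; apply: eq_bigr => i _; rewrite !mxE.
have bX2 t (i : 'I_p) := Lfun2Z (b i) (X2 t i).
have Y2 t : Y t \in Lfun P 2%:E by rewrite YE; exact: Lfun2_sum.
have Ymean t : dot P (Y (t + T)) (fun=> 1) = dot P (Y t) (fun=> 1).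
  have one2 := Lfun2_cst P 1.
  rewrite !YE !dot_suml//; apply: eq_bigr => i _.
  by rewrite !dotZl// Xmean.
have Ydot t v : dot P (Y (t + T)) (Y (v + T)) = dot P (Y t) (Y v).
  rewrite !YE dot_suml//; last exact: Lfun2_sum.
  rewrite [RHS]dot_suml//; last exact: Lfun2_sum.
  apply: eq_bigr => i _; rewrite !dot_sumr//; apply: eq_bigr => j _.
  by rewrite !dotZl// !dotZr// Xdot.
split=> // [t|t v]; first by rewrite !expectation_dot// Ymean.
by rewrite !covariance_dot// Ydot !Ymean.
Qed.
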